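(* Let $G$ be a planar bipartite graph. Then $s(G) \leq 4$, where $s(G)$ is the surrounding cop number of $G$.
   Context: Surrounding Cops and Robbers is a perfect-information game played on a finite graph $G$ by two players. The first player controls a team of cops $C_1,\dots,C_m$; the second controls one robber. Initially, the first player places each cop on some vertex of $G$, and then the second player places the robber on some vertex of $G$. Then the two players alternate in taking turns. On the first player's turn, she moves each cop to an adjacent vertex or leaves it at its current vertex. On the second player's turn, he moves the robber to an adjacent vertex or leaves the robber at its current vertex. Two cops may occupy the same vertex, and a cop and the robber may occupy the same vertex, but the second player may not end a turn with the robber on the same vertex as a cop. The first player wins if at any point the robber occupies a vertex $r$ such that each neighbor of $r$ is occupied by a cop (the robber is surrounded). The second player wins by indefinitely preventing the first player from winning. The surrounding cop number $s(G)$ of a finite graph $G$ is the minimum $m$ such that the first player, with a team of $m$ cops, has a winning strategy on $G$.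
   Formalization: The graph G is additionally assumed connected; without this the claim is false: for three disjoint 4-cycles, some cycle receives at most one of four cops, and a robber there is never surrounded. *)

(* Defs.v *)
From HB Require Import structures.
From mathcomp Require Import all_boot all_order all_algebra.
From mathcomp Require Import all_classical all_reals all_analysis.
Import Order.TTheory GRing.Theory Num.Theory.
Import numFieldNormedType.Exports.

Set Implicit Arguments.
Unset Strict Implicit.
Unset Printing Implicit Defensive.

Local Open Scope classical_set_scope.
Local Open Scope ring_scope.

Record sgraph := SGraph {
  vertex :> finType;
  adj : rel vertex;
  adj_sym : symmetric adj;
  adj_irrefl : irreflexive adj }.

Definition connected_graph (G : sgraph) : Prop :=
  forall x y : G, connect (@adj G) x y.

Definition bipartite (G : sgraph) : Prop :=
  exists side : G -> bool, forall x y : G, adj x y -> side x != side y.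

(* [arc x y] is only constrained when [x] and [y] are adjacent; [arc x y] and
   [arc y x] are the two parametrizations of the curve drawn for one edge. *)
Record plane_drawing (R : realType) (G : sgraph)
    (pos : G -> R * R) (arc : G -> G -> R -> R * R) : Prop := PlaneDrawing {
  pos_inj : injective pos;
  arc_continuous : forall x y, adj x y ->
    {within `[0, 1], continuous (arc x y)};
  arc_inj : forall x y, adj x y -> {in `[0, 1] &, injective (arc x y)};
  arc_start : forall x y, adj x y -> arc x y 0 = pos x;
  arc_end : forall x y, adj x y -> arc x y 1 = pos y;
  arc_reverse : forall x y, adj x y ->
    {in `[0, 1], forall t, arc y x t = arc x y (1 - t)};
  arc_avoids_vertices : forall x y z, adj x y ->
    {in `]0, 1[, forall t, arc x y t <> pos z};
  arc_disjoint : forall x y u v, adj x y -> adj u v ->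
    [set x; y]%SET != [set u; v]%SET ->
    {in `]0, 1[ &, forall s t, arc x y s <> arc u v t} }.

Definition planar (R : realType) (G : sgraph) : Prop :=
  exists pos arc, @plane_drawing R G pos arc.

Local Open Scope nat_scope.

Section Game.
Variable G : sgraph.

Definition step (x y : G) : bool := (x == y) || adj x y.

Section Team.
Variable m : nat.

Definition placement := {ffun 'I_m -> G}.

Definition occupied (c : placement) (x : G) : bool := [exists i, c i == x].

Definition surrounded (c : placement) (r : G) : bool :=
  [forall y, adj r y ==> occupied c y].

(* [sigma h] is the placement of the cops once the robber has successively been
   at the vertices listed in [h] (his initial vertex first): [sigma [::]] is
   their initial placement, and their earlier placements are the values of
   [sigma] at the prefixes of [h], so [sigma] sees the whole history. *)
Definition strategy := seq G -> placement.

Definition legal_strategy (sigma : strategy) : Prop :=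
  forall (h : seq G) (r : G) (i : 'I_m), step (sigma h i) (sigma (rcons h r) i).

(* The game goes [sigma [::]], [rho 0], [sigma [:: rho 0]], [rho 1], and so on:
   [cops sigma rho n] is the placement of the cops when the robber arrives at
   [rho n].  The initial placement of the robber is unrestricted. *)
Definition cops (sigma : strategy) (rho : nat -> G) (n : nat) : placement :=
  sigma (mkseq rho n).

Definition legal_robber (sigma : strategy) (rho : nat -> G) : Prop :=
  forall n, step (rho n) (rho n.+1) /\ ~~ occupied (cops sigma rho n.+1) (rho n.+1).

(* The robber can be surrounded after his own turn or after the cops' turn.
   Considering only infinite plays is harmless: a robber without a legal move
   has all his neighbors occupied. *)
Definition winning_strategy (sigma : strategy) : Prop :=
  legal_strategy sigma /\
  forall rho : nat -> G, legal_robber sigma rho ->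
    exists n, surrounded (cops sigma rho n) (rho n)
           \/ surrounded (cops sigma rho n.+1) (rho n).

End Team.

Definition cops_win (m : nat) : Prop :=
  exists sigma : strategy m, winning_strategy sigma.

Lemma cops_win_card : cops_win #|G|.
Proof.
exists (fun=> [ffun i => enum_val i]); split=> [h r i|rho _].
  by rewrite /step eqxx.
exists 0; left; apply/forallP => y; apply/implyP => _.
by apply/existsP; exists (enum_rank y); rewrite ffunE enum_rankK.
Qed.

Lemma exists_cops_win : exists m, `[< cops_win m >].
Proof. by exists #|G|; apply/asboolP; exact: cops_win_card. Qed.

Definition surrounding_cop_number : nat := ex_minn exists_cops_win.

End Game.

(* Main.v *)
Require Import Defs.
From mathcomp Require Import all_boot zify.
From mathcomp Require boolp.

Set Implicit Arguments.
Unset Strict Implicit.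
Unset Printing Implicit Defensive.

(** In a bipartite graph a geodesic [s] is guarded by two cops: if the robber is
    at distance [d] from [s 0], then his neighbors on [s] are among [s (d - 1)]
    and [s (d + 1)], and these two vertices move by at most one step when he
    does.  If moreover [s] has no detour of the same length through the robber's
    territory, then one cop is enough.  This lets four cops shrink the territory
    until the robber has no legal move.  Let the territory be enclosed by a cycle
    made of two arcs, each guarded by one cop.  The two free cops guard a geodesic
    through the territory that joins the first and the last vertex of one of the
    arcs next to the territory; by planarity the robber is then enclosed by the
    geodesic and only one of the two arcs, so one cop is free.  If the geodesic
    has detours, take one with lowest upper end.  The free cop settles above the
    robber's level on the detour; then a single one of the two cops of the
    geodesic is enough to guard it, the other one completes the guard of the
    detour, and the territory has shrunk again.

    Of planarity only the absence of a K_{3,3} minor is used.  It follows from a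
    parity argument in the style of Hanani-Tutte, applied to a polygonal
    approximation of the drawing in which vertex-disjoint edges remain disjoint. *)

(** * Finite games and strategies *)

Section Game.
Variable G : sgraph.
Implicit Types (c : seq G) (r : G).

Lemma stepxx (x : G) : step x x.
Proof. by rewrite /step eqxx. Qed.

Lemma adj_step (x y : G) : adj x y -> step x y.
Proof. by rewrite /step orbC => ->. Qed.

Lemma step_sym (x y : G) : step x y = step y x.
Proof. by rewrite /step eq_sym adj_sym. Qed.

(* The robber is to move from [r] against the team [c], and the cops can force
   him into a position without a legal move. *)
Inductive win c r : Prop := Win of forall r', step r r' -> r' \notin c ->
  exists2 c', all2 (@step G) c c' & win c' r'.

(** The recursive occurrence of [win] is nested under [exists2], so the induction principle is built
    by a structural [fix]. *)
Lemma win_induction (P : seq G -> G -> Prop) :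
  (forall c r, (forall r', step r r' -> r' \notin c ->
    exists2 c', all2 (@step G) c c' & P c' r') -> P c r) ->
  forall c r, win c r -> P c r.
Proof.
move=> HP; fix IH 3 => c r [w]; apply: HP => r' rr' r'c.
by destruct (w r' rr' r'c) as [c' st w']; exists c' => //; apply: IH.
Qed.

Lemma win_perm c1 c2 r : perm_eq c1 c2 -> win c1 r -> win c2 r.
Proof.
move=> eq12 w; move: c1 r w c2 eq12.
apply: win_induction => c1 r w c2 eq12; split => r' rr'; rewrite -(perm_mem eq12) => r'c1.
have [c1' st w'] := w r' rr' r'c1.
(* The permutation is recorded as a list of indices [Is], so that the reply [c1'] can be rearranged
   in the same way. *)
move: (eq12); rewrite perm_sym => /(perm_iotaP r)[Is eqIs ->].
exists [seq nth r c1' i | i <- Is]; last first.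
  apply: w'; rewrite perm_sym; apply/(perm_iotaP r); exists Is => //.
  by rewrite (eqP (_ : size c1' == size c1)) // eq_sym; move: st; rewrite all2E => /andP[].
have {eqIs} : all (fun i => i < size c1) Is.
  by rewrite (perm_all _ eqIs); apply/allP => i; rewrite mem_iota.
move: st; rewrite all2E => /andP[/eqP sz st].
elim: Is => //= i Is IHs /andP[isz /IHs ->]; rewrite andbT.
have : (nth r c1 i, nth r c1' i) \in zip c1 c1'.
  by rewrite -(nth_zip r r i sz) mem_nth // size_zip -sz minnn.
by move/(allP st).
Qed.

Fixpoint wins_in n c r : Prop :=
  if n is n'.+1 then forall r', step r r' -> r' \notin c ->
    exists2 c', all2 (@step G) c c' & wins_in n' c' r'
  else False.

Lemma wins_in_leq m n c r : m <= n -> wins_in m c r -> wins_in n c r.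
Proof.
elim: n m c r => [|n IH] [|m] c r //= mn w r' rr' r'c.
by have [c' st w'] := w r' rr' r'c; exists c' => //; apply: (IH m).
Qed.

(** The robber has finitely many moves, so the bounds attached to them have a maximum. *)
Lemma win_wins_in c r : win c r -> exists n, wins_in n c r.
Proof.
move: c r; apply: win_induction => c r w.
have [r'|N NP] := boolp.choice (_ : forall r', exists n, step r r' ->
    r' \notin c -> exists2 c', all2 (@step G) c c' & wins_in n c' r').
  have [[rr' r'c]|no] := boolp.pselect (step r r' /\ r' \notin c).
    by have [c' st [n wn]] := w r' rr' r'c; exists n => _ _; exists c'.
  by exists 0 => rr' r'c; case: no.
exists (\max_x N x).+1 => r' rr' r'c.
have [c' st wn] := NP r' rr' r'c; exists c' => //.
by apply: wins_in_leq wn; apply: leq_bigmax.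
Qed.

(* Replies are chosen so as to minimize the number of remaining rounds: a
   strategy that merely stays in winning positions could cycle. *)
Lemma win_strategy c0 : size c0 = 4 ->
  (forall r, exists2 c, all2 (@step G) c0 c & win c r) -> cops_win G 4.
Proof.
move=> sz0 hr.
have refl c : all2 (@step G) c c by elim: c => //= x c ->; rewrite stepxx.
have resp c r : exists c', all2 (@step G) c c' /\ forall n,
    (exists2 c'', all2 (@step G) c c'' & wins_in n c'' r) -> wins_in n c' r.
  pose P n := boolp.asbool (exists2 c', all2 (@step G) c c' & wins_in n c' r).
  have [/ex_minnP[m /boolp.asboolP[c' st wm] mmin]|no] := boolp.pselect (exists n, P n).
    exists c'; split=> // n /boolp.asboolP Pn.
    by apply: wins_in_leq wm; apply: mmin.
  by exists c; split=> // n /boolp.asboolP Pn; case: no; exists n.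
have [f fP] := boolp.choice (fun p => resp p.1 p.2).
pose st := foldl (fun c r => f (c, r)) c0.
have st_rcons h r : st (rcons h r) = f (st h, r) by rewrite /st foldl_rcons.
have stepst h r : all2 (@step G) (st h) (st (rcons h r)).
  by rewrite st_rcons; have [] := fP (st h, r).
have sz h : size (st h) = 4.
  elim/last_ind: h => // h r <-; have := stepst h r.
  by rewrite all2E => /andP[/eqP].
have [x0 _|G0] := pickP (mem (@predT G)); last first.
  by case: c0 sz0 {hr st st_rcons stepst sz} => // x; have := G0 x.
pose sigma h : placement G 4 := [ffun i : 'I_4 => nth x0 (st h) i].
have occ h x : occupied (sigma h) x = (x \in st h).
  apply/existsP/idP => [[i]|/(nthP x0)[i]].
    by rewrite ffunE => /eqP<-; rewrite mem_nth // sz.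
  by rewrite sz => i4 <-; exists (Ordinal i4); rewrite ffunE.
exists sigma; split=> [h r i|rho leg].
  rewrite !ffunE; have := stepst h r; rewrite all2E => /andP[/eqP se].
  move/(all_nthP (x0, x0))/(_ i); rewrite size_zip -se minnn sz.
  by rewrite nth_zip //=; apply.
(* The robber runs out of legal moves after finitely many rounds, so an infinite legal play is
   already contradictory: by [key] the remaining bound drops in each round. *)
exfalso.
have mk n : mkseq rho n.+1 = rcons (mkseq rho n) (rho n).
  by rewrite -cats1 /mkseq -[n.+1]addn1 iotaD map_cat add0n.
have key m n : wins_in m (st (mkseq rho n.+1)) (rho n) -> False.
  elim: m n => //= m IH n w; have [rr' nocc] := leg n.
  apply: (IH n.+1); rewrite mk st_rcons.
  have [_] := fP (st (mkseq rho n.+1), rho n.+1); apply; apply: w => //.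
  by rewrite -occ.
have [c cc w] := hr (rho 0); have [m wm] := win_wins_in w.
apply: (key m 0); rewrite mk st_rcons /=.
by have [_] := fP (c0, rho 0); apply; exists c.
Qed.

End Game.

(** * Guarding and chasing *)

Section Pursuit.
Variable G : sgraph.
Hypothesis connG : connected_graph G.
Implicit Types (W : {set G}) (f g h : G -> G) (r x y : G) (s : nat -> G) (d : G -> nat).

Definition shadow W f := {in W &, forall r r', adj r r' -> step (f r) (f r')}.

(** Cops placed at these three shadows of the robber can follow him inside [W] and always occupy
    every exit next to him. *)
Definition guards W f g h := [/\ shadow W f, shadow W g, shadow W h &
  {in W, forall r v, v \notin W -> adj r v -> v \in [:: f r; g r; h r]}].

Lemma shadow_step W f r r' : shadow W f -> r \in W -> r' \in W -> step r r' ->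
  step (f r) (f r').
Proof.
move=> sf rW r'W /orP[/eqP->|]; first exact: stepxx.
exact: sf.
Qed.

Lemma shadow_const W x : shadow W (fun=> x).
Proof. by move=> *; apply: stepxx. Qed.

(** The three guards answer automatically, so only the fourth cop needs a reply. *)
Lemma win_confined W f g h r x : guards W f g h -> r \in W ->
  (forall r', r' \in W -> step r r' -> r' \notin [:: f r; g r; h r; x] ->
     exists2 x', step x x' & win [:: f r'; g r'; h r'; x'] r') ->
  win [:: f r; g r; h r; x] r.
Proof.
move=> [sf sg sh cov] rW IH; split => r' rr' r'c.
have r'W : r' \in W.
  case/orP: (rr') => [/eqP<-//|arr']; apply/negPn/negP => /(cov _ rW)/(_ arr') r'g.
  by move: r'c r'g; rewrite !inE !negb_or => /and4P[/negPf-> /negPf-> /negPf-> _].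
have [x' xx' w] := IH r' r'W rr' r'c.
by exists [:: f r'; g r'; h r'; x'] => //=; rewrite xx' !(@shadow_step W).
Qed.

(** The fourth cop walks to [s 0] and climbs along [s]. The target level [d r] is bounded and falls
    by at most one per round, so a cop climbing from below cannot miss it; on equality it waits. *)
Lemma chase W f g h s d : guards W f g h ->
  (forall n, step (s n) (s n.+1)) ->
  {in W &, forall r r', adj r r' -> d r <= (d r').+1} ->
  {in W, forall r, win [:: f r; g r; h r; s (d r)] r} ->
  forall r x, r \in W -> win [:: f r; g r; h r; x] r.
Proof.
move=> gW ss dL wW.
have catchup n t r : r \in W -> t <= d r -> \max_x d x < t + n ->
    win [:: f r; g r; h r; s t] r.
  elim: n t r => [|n IH] t r rW tr tn.
    by have := leq_bigmax (F := d) r; lia.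
  move: tr; rewrite leq_eqVlt => /orP[/eqP->|tr]; first exact: wW.
  apply: (win_confined gW) => // r' r'W rr' _.
  have d' : d r <= (d r').+1.
    by case/orP: rr' => [/eqP->//|]; exact: dL.
  have [->|tr'] := eqVneq t (d r').
    by exists (s (d r')); [exact: stepxx|exact: wW].
  exists (s t.+1) => //; apply: IH => //; lia.
move=> r x rW; have /connectP[p] := connG x (s 0).
elim: p x r rW => [|y p IH] x r rW /=.
  by move=> _ <-; apply: (catchup (\max_x d x).+1); rewrite ?ltnS ?add0n.
move=> /andP[axy pp] lp; apply: (win_confined gW) => // r' r'W _ _.
by exists y; [exact: adj_step|exact: IH].
Qed.

(* The fourth cop steps onto a robber standing on [s]; from then on that cop
   stays at the robber's level until the robber stops descending. *)
Lemma push W f g s d : guards W f g (fun r => s (d r).+1) ->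
  (forall n, step (s n) (s n.+1)) ->
  {in W &, forall r r', adj r r' -> d r' = (d r).+1 \/ d r = (d r').+1} ->
  {in W, forall r, r != s (d r) ->
    win [:: f r; g r; s (d r).+1; s (d r).-1] r} ->
  forall r x, r \in W -> win [:: f r; g r; s (d r).+1; x] r.
Proof.
move=> gW ss dL wW r x rW.
(* The fourth cop is on the robber's own level and follows a descent. If the robber stays or climbs,
   this cop ends one level below him, and he is off [s] because a cop was on [s] at his new
   level. *)
have level r' : r' \in W -> win [:: f r'; g r'; s (d r').+1; s (d r')] r'.
  have [n] := ubnP (d r'); elim: n r' => // n IH r0 lt r0W.
  apply: (win_confined gW) => // r1 r1W /orP[/eqP<-|a01] r1c.
    exists (s (d r0).-1).
      by case: (d r0) => [|k] /=; rewrite ?stepxx // step_sym.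
    by apply: wW => //; move: r1c; rewrite !inE !negb_or => /and4P[].
  have [e|e] := dL _ _ r0W r1W a01.
    exists (s (d r0)); first exact: stepxx.
    rewrite -[d r0]/(d r0).+1.-1 -e; apply: wW => //.
    by move: r1c; rewrite !inE !negb_or e => /and4P[].
  exists (s (d r1)); first by rewrite e step_sym.
  by apply: IH => //; lia.
apply: (chase (s := s) (d := fun r => (d r).-1) gW) => // [r1 r2 r1W r2W a12|r1 r1W].
  by have := dL _ _ r1W r2W a12; lia.
(* The robber may stand on [s]. If he stays there, the cop below steps onto him; if he leaves, both
   neighboring levels of [s] are occupied, so he is off [s]. *)
have [r1s|] := eqVneq r1 (s (d r1)); last exact: wW.
apply: (win_confined gW) => // r2 r2W /orP[/eqP<-|a12] r2c.
  exists (s (d r1)); last exact: level.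
  by case: (d r1) => [|k] /=; rewrite ?stepxx.
exists (s (d r2).-1).
  by have [->|->] := dL _ _ r1W r2W a12 => /=; [|rewrite step_sym];
    case: (d _) => [|k] //=; rewrite ?stepxx.
apply: wW => //; apply: contraNneq r2c => {1}->; rewrite !inE.
by have [->|->] := dL _ _ r1W r2W a12; rewrite /= eqxx ?orbT.
Qed.

End Pursuit.

(** * Components and geodesics *)

Section Connectivity.
Variable G : sgraph.
Implicit Types (A S : {set G}) (x y r : G).

Definition induced A : rel G := fun x y => [&& x \in A, y \in A & adj x y].

Definition connected_in A := {in A &, forall x y, connect (induced A) x y}.

Definition component A r := [set x in A | connect (induced A) r x].

Lemma induced_sym A : connect_sym (induced A).
Proof. by apply: sym_connect_sym => x y; rewrite /induced adj_sym andbCA. Qed.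

Lemma component_sub A r : component A r \subset A.
Proof. by apply/subsetP => x; rewrite inE => /andP[]. Qed.

Lemma mem_component A r : r \in A -> r \in component A r.
Proof. by move=> rA; rewrite inE rA connect0. Qed.

Lemma component_closed A r x y :
  x \in component A r -> y \in A -> adj x y -> y \in component A r.
Proof.
rewrite !inE => /andP[xA cx] yA axy; rewrite yA.
by apply: connect_trans cx (connect1 _); rewrite /induced xA yA.
Qed.

Lemma component_connected A r : connected_in (component A r).
Proof.
have base y : y \in component A r -> connect (induced (component A r)) r y.
  rewrite inE => /andP[_ /connectP[p]].
  elim/last_ind: p y => [|p z IH] y /= pp ->; first exact: connect0.
  rewrite last_rcons; move: pp; rewrite rcons_path => /andP[pp /and3P[lA zA alz]].
  apply: connect_trans (IH _ pp erefl) (connect1 _).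
  have lC : last r p \in component A r.
    by rewrite inE lA; apply/connectP; exists p.
  by rewrite /induced lC alz (component_closed lC).
move=> x y xC yC; apply: connect_trans (base y yC).
by rewrite induced_sym base.
Qed.

(** Taken from the first entry into [S] of a walk from [r] to [x]; it shows later that the new
    territory touches the geodesic just guarded. *)
Lemma component_exit A S r x : connected_in A -> r \in A :\: S -> x \in A :&: S ->
  exists u v, [/\ u \in component (A :\: S) r, v \in A :&: S & adj u v].
Proof.
move=> cA rAS; rewrite inE => /andP[xA xS].
have rA : r \in A by move: rAS; rewrite inE => /andP[].
have /connectP[p] := cA r x rA xA.
elim: p r rA rAS => [|z p IH] r rA rAS /=.
  by move=> _ e; move: rAS; rewrite -e inE xS.
case/andP => /and3P[_ zA arz] pp lp.
have rC := mem_component rAS.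
have [zS|zS] := boolP (z \in S); first by exists r, z; split=> //; rewrite inE zA zS.
have zAS : z \in A :\: S by rewrite inE zS zA.
have [u [v [uC vS auv]]] := IH z zA zAS pp lp.
exists u, v; split=> //; have zC := component_closed rC zAS arz.
move: zC uC; rewrite !inE => /andP[_ crz] /andP[-> czu] /=.
exact: connect_trans crz czu.
Qed.

End Connectivity.

Section Geodesic.
Variables (G : sgraph) (e : rel G) (x : G).
Hypothesis bipG : bipartite G.
Hypothesis e_adj : subrel e (@adj G).

(** Here [d] is the distance from [x] along [e], and [s] is a shortest path, constant after reaching
    [y]. Bipartiteness fixes the parity of walks with given ends, so neighbors are never at equal
    distance. *)
Lemma geodesic y : connect e x y -> exists (d : G -> nat) (s : nat -> G),
  [/\ s 0 = x, forall l, d y <= l -> s l = y,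
      forall l, l < d y -> e (s l) (s l.+1),
      forall l, l <= d y -> d (s l) = l &
      forall u v, e u v -> e v u -> connect e x u -> d v = (d u).+1 \/ d u = (d v).+1].
Proof.
move=> cxy.
have [u|d dP] := boolp.choice (_ : forall u, exists n, connect e x u ->
    (exists p, [/\ path e x p, last x p = u & size p = n]) /\
    forall p, path e x p -> last x p = u -> n <= size p).
  pose P n := boolp.asbool (exists p, [/\ path e x p, last x p = u & size p = n]).
  have [/ex_minnP[m /boolp.asboolP Pm mmin]|no] := boolp.pselect (exists n, P n).
    exists m => _; split=> // p pp lp; apply: mmin; apply/boolp.asboolP; by exists p.
  (* Unreachable vertices get the default distance 0. *)
  exists 0 => /connectP[p pp lp]; case: no; exists (size p).
  by apply/boolp.asboolP; exists p.
have [side sideP] := bipG.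
have parity p : path e x p -> side (last x p) = side x (+) odd (size p).
  elim/last_ind: p => [|p z IH] /=; first by rewrite addbF.
  rewrite rcons_path last_rcons size_rcons => /andP[/IH sp /e_adj/sideP].
  by rewrite sp /= ; case: (side x) (side z) (odd _) => [] [] [].
have dlip u v : e u v -> connect e x u -> d v <= (d u).+1.
  move=> euv cu; have [[p [pp lp sp]] _] := dP u cu.
  have [|_ dmin] := dP v; first exact: connect_trans cu (connect1 euv).
  by rewrite -sp -(size_rcons p v); apply: dmin; rewrite ?last_rcons // rcons_path pp lp.
have [[p [pp lp sp]] pmin] := dP y cxy.
(* A prefix of a shortest path is shortest: a shorter [q] could be continued by [drop l p]. *)
have dpre l : l <= d y -> d (nth y (x :: p) l) = l.
  move=> ly; have lx : nth y (x :: p) l = last x (take l p).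
    by rewrite (last_nth y) size_takel ?sp // -[x :: take l p]/(take l.+1 (x :: p)) nth_take.
  have ptk : path e x (take l p) /\ path e (last x (take l p)) (drop l p).
    by apply/andP; rewrite -cat_path cat_take_drop.
  have cu : connect e x (last x (take l p)) by apply/connectP; exists (take l p) => //; case: ptk.
  rewrite lx; have [[q [qp lq sq]] qmin] := dP _ cu.
  apply/eqP; rewrite eqn_leq; apply/andP; split.
    by rewrite -{2}(size_takel (_ : l <= size p)) ?sp //; apply: qmin => //; case: ptk.
  case: ptk => _ ptk; have := pmin (q ++ drop l p).
  rewrite cat_path qp lq ptk last_cat lq -last_cat cat_take_drop => /(_ isT lp).
  rewrite size_cat size_drop sq sp; move: ly; rewrite /=; lia.
exists d, (nth y (x :: p)); split=> //.
- move=> [|l] ly /=; first by move: ly lp; rewrite -sp leqn0 => /nilP ->.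
  move: ly; rewrite leq_eqVlt => /orP[/eqP e1|ly]; last by rewrite nth_default // sp.
  by rewrite -lp -nth_last sp e1 /=; apply: set_nth_default; rewrite sp e1.
- by move=> l ly; apply: (pathP y pp); rewrite sp.
move=> u v euv evu cu; have cv := connect_trans cu (connect1 euv).
have h1 := dlip u v euv cu; have h2 := dlip v u evu cv.
have [[q [qp lq sq]] _] := dP u cu; have [[q' [qp' lq' sq']] _] := dP v cv.
have : odd (d u) != odd (d v).
  have su : side u = side x (+) odd (d u) by rewrite -sq -(parity q) ?lq.
  have sv : side v = side x (+) odd (d v) by rewrite -sq' -(parity q') ?lq'.
  by have := sideP _ _ (e_adj euv); rewrite su sv; apply: contraNneq => ->.
have [->|] := eqVneq (d u) (d v); rewrite ?eqxx // => ne _; lia.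
Qed.

End Geodesic.

(** * Planarity modulo two *)

From mathcomp Require Import all_order all_algebra ring lra.
Import Order.TTheory GRing.Theory Num.Theory.

(** Supplies the disjointness needed for [walk_cross] between the start of one path and the end of
    another; membership is expressed by counting so that [lia] decides it. *)
Lemma uniq_disjoint (T : eqType) (x y m m' : T) l r l' r' :
  uniq (x :: y :: (l ++ m :: r) ++ (l' ++ m' :: r')) ->
  ~~ has (mem (x :: rcons l m)) (m' :: rcons r' y) /\
  m' \notin x :: rcons (l ++ m :: r) y.
Proof.
have mem_count (z : T) s : (z \in s) = (0 < count_mem z s) by rewrite -has_pred1 has_count.
have count_rcons z (s : seq T) u : count_mem z (rcons s u) = count_mem z s + (u == z).
  by rewrite -cats1 count_cat /= addn0.
move=> uq; have le1 z : count_mem z (x :: y :: (l ++ m :: r) ++ (l' ++ m' :: r')) <= 1.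
  by rewrite count_uniq_mem // leq_b1.
split.
  apply/hasPn => z; rewrite /= !mem_count /= !count_rcons.
  have := le1 z; rewrite /= !count_cat /=; lia.
rewrite mem_count /= count_rcons count_cat /=.
have := le1 m'; rewrite /= !count_cat /= eqxx; lia.
Qed.

Section Theta.
Variable G : sgraph.
Local Open Scope ring_scope.

(* [rho a b z] is the parity of the number of crossings of the curve drawn for
   the edge [a b] with the vertical ray going up from [z], and [sigma] is the
   left-to-right order.  Bool is viewed as the two-element field. *)
Definition parity_drawing (rho : G -> G -> G -> bool) (sigma : rel G) :=
  (forall x y, x != y -> sigma x y + sigma y x = true) /\
  forall a b c d, adj a b -> adj c d -> ~~ has (mem [:: a; b]) [:: c; d] ->
    rho a b d - rho a b c + rho c d b - rho c d a =
    sigma b d - sigma b c - sigma a d + sigma a c.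

Variables (rho : G -> G -> G -> bool) (sigma : rel G).
Hypothesis drawing : parity_drawing rho sigma.

Fixpoint walk_parity (x : G) p (z : G) : bool :=
  if p is y :: p' then rho x y z + walk_parity y p' z else 0.

Lemma walk_parity_cat x p q z :
  walk_parity x (p ++ q) z = walk_parity x p z + walk_parity (last x p) q z.
Proof. by elim: p x => [|y p IH] x /=; rewrite ?add0r // IH addrA. Qed.

(** The law for two disjoint edges is additive: summed first over the edges of one walk, then of the
    other, both sides telescope. *)
Lemma walk_cross x p u q : path (@adj G) x p -> path (@adj G) u q ->
  ~~ has (mem (x :: p)) (u :: q) ->
  walk_parity x p (last u q) - walk_parity x p u +
    walk_parity u q (last x p) - walk_parity u q x =
  sigma (last x p) (last u q) - sigma (last x p) u - sigma x (last u q) + sigma x u.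
Proof.
have edge a b u' q' : adj a b -> path (@adj G) u' q' -> ~~ has (mem [:: a; b]) (u' :: q') ->
    rho a b (last u' q') - rho a b u' + walk_parity u' q' b - walk_parity u' q' a =
    sigma b (last u' q') - sigma b u' - sigma a (last u' q') + sigma a u'.
  move=> aab; elim: q' u' => [|v q' IH] u' /=; first by move=> _ _; ring.
  move=> /andP[auv qp] dis.
  have h1 : ~~ has (mem [:: a; b]) (v :: q').
    by apply: contra dis => h; apply/orP; right.
  have h2 : ~~ has (mem [:: a; b]) [:: u'; v].
    by apply: contra dis => /=; case: (_ \in _) => //=; rewrite orbF => ->.
  move: (congr2 +%R (IH v qp h1) (drawing.2 a b u' v aab auv h2)) => E.
  rewrite [RHS](_ : _ = sigma b (last v q') - sigma b v - sigma a (last v q') +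
      sigma a v + (sigma b v - sigma b u' - sigma a v + sigma a u')); last by ring.
  rewrite -E; ring.
elim: p x => [|y p IH] x /=; first by move=> _ _ _; ring.
move=> /andP[axy pp] uq dis.
have E1 := IH y pp uq; have E2 := edge x y u q axy uq.
have h1 : ~~ has (mem (y :: p)) (u :: q).
  by apply: contra dis; apply: sub_has => z h; apply/orP; right.
have h2 : ~~ has (mem [:: x; y]) (u :: q).
  by apply: contra dis; apply: sub_has => z /=; rewrite !inE => /orP[] ->; rewrite ?orbT.
move: (congr2 +%R (E1 h1) (E2 h2)) => E.
rewrite [RHS](_ : _ = sigma (last y p) (last u q) - sigma (last y p) u - sigma y (last u q) +
      sigma y u + (sigma y (last u q) - sigma y u - sigma x (last u q) + sigma x u)); last by ring.
rewrite -E; ring.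
Qed.

Definition touches (K : {set G}) (p : seq G) :=
  exists2 m, m \in p & exists2 k, k \in K & adj k m.

(** Walks from a common [k] to the three paths stand in for the edges of K_{3,3} at the contracted
    set [K]. *)
Lemma walk_to_touched (K : {set G}) k p : connected_in K -> k \in K -> touches K p ->
  exists q m, [/\ m \in p, path (@adj G) k q, last k q = m &
                 {in k :: q, forall z, z \in K \/ z = m}].
Proof.
move=> cK kK [m mp [k' k'K akm]]; have /connectP[q qp lq] := cK k k' kK k'K.
exists (rcons q m), m; rewrite last_rcons rcons_path -lq akm andbT; split=> //.
  by apply: sub_path qp => a b /and3P[].
have qK : {subset k :: q <= K}.
  elim: q k kK qp {lq} => [|b q IH] k0 k0K /=; first by move=> _ z; rewrite inE => /eqP->.
  case/andP=> /and3P[_ bK _] /(IH b bK) sub z; rewrite inE => /orP[/eqP->//|]; exact: sub.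
move=> z; rewrite -rcons_cons mem_rcons inE => /orP[/eqP->|/qK]; by [right|left].
Qed.

(* A K_{3,3} with [x], [y] and [K] on one side and the three paths on the other.
   Summing [walk_cross] over the pairs formed by the part of one path from [x] to
   its neighbor [m_i] of [K] and the part of another path from [m_j] to [y], and
   over the pairs formed by a path and a walk in [K], leaves only the terms
   [sigma m_i m_j + sigma m_j m_i = 1], three in number. *)
Lemma theta_free x y p1 p2 p3 (K : {set G}) : uniq (x :: y :: p1 ++ p2 ++ p3) ->
  path (@adj G) x (rcons p1 y) -> path (@adj G) x (rcons p2 y) ->
  path (@adj G) x (rcons p3 y) ->
  connected_in K -> {in x :: y :: p1 ++ p2 ++ p3, forall z, z \notin K} ->
  touches K p1 -> touches K p2 -> touches K p3 -> False.
Proof.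
move=> uq P1 P2 P3 cK disK t1 t2 t3.
have [_ _ [k kK _]] := t1.
have [q1 [m1 [m1p q1p l1 q1K]]] := walk_to_touched cK kK t1.
have [q2 [m2 [m2p q2p l2 q2K]]] := walk_to_touched cK kK t2.
have [q3 [m3 [m3p q3p l3 q3K]]] := walk_to_touched cK kK t3.
have branch p q m : path (@adj G) x (rcons p y) -> path (@adj G) k q -> last k q = m ->
    {in k :: q, forall z, z \in K \/ z = m} -> m \notin x :: rcons p y ->
    {in x :: rcons p y, forall z, z \notin K} ->
    walk_parity x (rcons p y) m - walk_parity x (rcons p y) k +
      walk_parity k q y - walk_parity k q x =
    sigma y m - sigma y k - sigma x m + sigma x k.
  move=> pp qp lq qK mp pK; have := @walk_cross x (rcons p y) k q pp qp.
  rewrite lq last_rcons; apply; apply/hasPn => z /qK[zK|->] //.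
  by apply/negP => /pK; rewrite zK.
have cross l m r l' m' r' : path (@adj G) x (rcons (l ++ m :: r) y) ->
    path (@adj G) x (rcons (l' ++ m' :: r') y) ->
    uniq (x :: y :: (l ++ m :: r) ++ (l' ++ m' :: r')) ->
    walk_parity x (rcons l m) y - walk_parity x (rcons l m) m' +
      walk_parity m' (rcons r' y) m - walk_parity m' (rcons r' y) x =
    sigma m y - sigma m m' - sigma x y + sigma x m'.
  rewrite !rcons_cat !cat_path /= => /and3P[h1 h2 _] /and3P[_ _ h3] /uniq_disjoint[dis _].
  have := @walk_cross x (rcons l m) m' (rcons r' y); rewrite !last_rcons.
  by apply=> //; rewrite rcons_path h1.
have u12 : uniq (x :: y :: p1 ++ p2).
  by apply: subseq_uniq uq; rewrite /= !eqxx catA prefix_subseq.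
have u13 : uniq (x :: y :: p1 ++ p3).
  by apply: subseq_uniq uq; rewrite /= !eqxx cat_subseq // suffix_subseq.
have u23 : uniq (x :: y :: p2 ++ p3).
  by apply: subseq_uniq uq; rewrite /= !eqxx suffix_subseq.
have flip p q : uniq (x :: y :: p ++ q) -> uniq (x :: y :: q ++ p).
  by rewrite (@perm_uniq _ (x :: y :: p ++ q) (x :: y :: q ++ p)) // !perm_cons perm_catC.
have outK p : {subset p <= p1 ++ p2 ++ p3} -> {in x :: rcons p y, forall z, z \notin K}.
  move=> sub z zp; apply: disK; move: zp; rewrite !inE mem_rcons inE.
  by case/or3P=> [->|->|/sub->]; rewrite ?orbT.
have [oK1 oK2 oK3] : [/\ {in x :: rcons p1 y, forall z, z \notin K},
    {in x :: rcons p2 y, forall z, z \notin K} & {in x :: rcons p3 y, forall z, z \notin K}].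
  by split; apply: outK => z; rewrite !mem_cat => ->; rewrite ?orbT.
have cat l m r z : walk_parity x (rcons (l ++ m :: r) y) z =
    walk_parity x (rcons l m) z + walk_parity m (rcons r y) z.
  by rewrite rcons_cat /= -cat_rcons walk_parity_cat last_rcons.
clear uq disK outK.
move: (flip _ _ u12) (flip _ _ u13) (flip _ _ u23) => u21 u31 u32.
case/splitPr: m1p u12 u13 u21 u31 P1 oK1 => l1' r1'.
case/splitPr: m2p u23 u32 P2 oK2 => l2' r2'.
case/splitPr: m3p P3 oK3 => l3' r3' P3 oK3 u23 u32 P2 oK2 u12 u13 u21 u31 P1 oK1.
(* Each ordered pair of paths enters with the sign of its cyclic orientation, so that [ring] cancels
   all other terms without characteristic two, which is used only at the very end. *)
have E := congr2 +%R (congr2 +%R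
   (congr2 (fun a b => a - b) (cross _ _ _ _ _ _ P1 P2 u12) (cross _ _ _ _ _ _ P1 P3 u13))
   (congr2 (fun a b => a - b) (cross _ _ _ _ _ _ P2 P3 u23) (cross _ _ _ _ _ _ P2 P1 u21)))
   (congr2 (fun a b => a - b) (cross _ _ _ _ _ _ P3 P1 u31) (cross _ _ _ _ _ _ P3 P2 u32)).
have F := congr2 +%R (congr2 +%R
   (congr2 (fun a b => a - b) (branch _ _ _ P2 q1p l1 q1K (uniq_disjoint u21).2 oK2)
                              (branch _ _ _ P3 q1p l1 q1K (uniq_disjoint u31).2 oK3))
   (congr2 (fun a b => a - b) (branch _ _ _ P3 q2p l2 q2K (uniq_disjoint u32).2 oK3)
                              (branch _ _ _ P1 q2p l2 q2K (uniq_disjoint u12).2 oK1)))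
   (congr2 (fun a b => a - b) (branch _ _ _ P1 q3p l3 q3K (uniq_disjoint u13).2 oK1)
                              (branch _ _ _ P2 q3p l3 q3K (uniq_disjoint u23).2 oK2)).
rewrite !cat in F.
have mm (m m' : G) p q : m \in p -> m' \in q -> uniq (x :: y :: p ++ q) -> m != m'.
  move=> mp m'q /=; rewrite cat_uniq => /and5P[_ _ _ /hasPn h _].
  by apply: contraTneq m'q => <-; apply: contraL mp; apply: h.
have ml (m : G) l r : m \in l ++ m :: r by rewrite mem_cat inE eqxx orbT.
have s12 := drawing.1 _ _ (mm _ _ _ _ (ml _ _ _) (ml _ _ _) u12).
have s13 := drawing.1 _ _ (mm _ _ _ _ (ml _ _ _) (ml _ _ _) u13).
have s23 := drawing.1 _ _ (mm _ _ _ _ (ml _ _ _) (ml _ _ _) u23).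
have S := congr2 +%R (congr2 +%R s12 s13) s23.
have : true + true + true = 0 :> bool; last by [].
rewrite -{}S.
have sub0 (a b c d : bool) : a = b -> c = d -> a = c -> b - d = 0.
  by move=> <- <- ->; rewrite subrr.
have R : sigma m1 m3 - sigma m1 m2 + sigma m2 m1 - sigma m2 m3 + sigma m3 m2 - sigma m3 m1 = 0.
  rewrite -(sub0 _ _ _ _ E F); ring.
by move: R; do 6 case: (sigma _ _).
Qed.

End Theta.

(** * Splitting sequences, rearranging arcs and cops *)

Section Seqs.
Variable T : Type.
Implicit Types (P : pred T) (s : seq T).

Lemma split_first P s : has P s ->
  exists s1 a s2, [/\ s = s1 ++ a :: s2, P a & ~~ has P s1].
Proof.
elim: s => //= x s IH; have [Px _|nPx /= /IH[s1 [a [s2 [-> Pa n1]]]]] := boolP (P x).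
  by exists [::], x, s.
by exists (x :: s1), a, s2; rewrite /= negb_or nPx.
Qed.

Lemma split_last P s : has P s ->
  exists s1 a s2, [/\ s = s1 ++ a :: s2, P a & ~~ has P s2].
Proof.
rewrite -has_rev => /split_first[s1 [a [s2 [e Pa n1]]]].
exists (rev s2), a, (rev s1); rewrite has_rev; split=> //.
by rewrite -[s]revK e rev_cat rev_cons cat_rcons.
Qed.

Lemma split_first_last P s : 1 < count P s ->
  exists s1 a s2 b s3, [/\ s = s1 ++ a :: s2 ++ b :: s3, P a, P b, ~~ has P s1 & ~~ has P s3].
Proof.
move=> cs; have /split_first[s1 [a [s' [e Pa n1]]]] : has P s by rewrite has_count; lia.
have /split_last[s2 [b [s3 [e' Pb n3]]]] : has P s'.
  rewrite has_count; move: cs; rewrite e count_cat /= Pa.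
  by move: n1; rewrite has_count -eqn0Ngt => /eqP->.
by exists s1, a, s2, b, s3; rewrite e e'.
Qed.

End Seqs.

Section Arcs.
Variables (T : eqType) (a b : T) (p q r : seq T).

Lemma perm_arcs : perm_eq ((a :: p ++ b :: q) ++ r) (a :: b :: p ++ r ++ q).
Proof. by apply/permP => P; rewrite /= !count_cat /=; lia. Qed.

Lemma perm_arcs_rev : perm_eq ((a :: r ++ b :: rev p) ++ q) (a :: b :: p ++ r ++ q).
Proof. by apply/permP => P; rewrite /= !count_cat /= count_rev; lia. Qed.

Lemma perm_arcs_r : perm_eq ((a :: r ++ b :: q) ++ p) (a :: b :: p ++ r ++ q).
Proof. by apply/permP => P; rewrite /= !count_cat /=; lia. Qed.

Lemma perm_rot_arcs : perm_eq (r ++ a :: p ++ b :: q) (a :: p ++ b :: (q ++ r)).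
Proof. by rewrite perm_catC /= -catA. Qed.

End Arcs.

Section Permutations.
Variable G : sgraph.
Implicit Types a b c d r : G.

Lemma win_swap34 a b c d r : win [:: a; b; c; d] r -> win [:: a; b; d; c] r.
Proof. by apply: win_perm; rewrite !perm_cons (perm_catC [:: c] [:: d]). Qed.

Lemma win_swap23 a b c d r : win [:: a; b; c; d] r -> win [:: a; c; b; d] r.
Proof. by apply: win_perm; rewrite perm_cons (perm_catCA [:: b] [:: c] [:: d]). Qed.

Lemma win_swap12 a b c d r : win [:: a; b; c; d] r -> win [:: b; a; c; d] r.
Proof. by apply: win_perm; rewrite (perm_catCA [:: a] [:: b] [:: c; d]). Qed.

Lemma win_rot a b c d r : win [:: a; b; c; d] r -> win [:: d; a; b; c] r.
Proof. by apply: win_perm; rewrite (perm_catC [:: a; b; c] [:: d]). Qed.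

Lemma win_rev a b c d r : win [:: a; b; c; d] r -> win [:: d; c; b; a] r.
Proof. by apply: win_perm; rewrite perm_sym (perm_rev [:: a; b; c; d]). Qed.

End Permutations.

Section Cycles.
Variable G : sgraph.
Implicit Types (p q : seq G) (s : nat -> G).

Lemma rev_arc a b q : path (@adj G) b (rcons q a) -> path (@adj G) a (rcons (rev q) b).
Proof.
move=> h; rewrite -rev_cons -[a in path _ a](last_rcons b q a) -(belast_rcons b q a) rev_path.
by apply: sub_path h => x y; rewrite adj_sym.
Qed.

Lemma cycle_arcs q1 a p b q2 :
  cycle (@adj G) (q1 ++ a :: p ++ b :: q2) =
  path (@adj G) a (rcons p b) && path (@adj G) b (rcons (q2 ++ q1) a).
Proof.
rewrite -(rot_cycle (size q1)) rot_size_cat /= -catA /= rcons_cat /=.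
by rewrite -cat_rcons cat_path last_rcons.
Qed.

Definition seg s i j := [seq s l | l <- index_iota i j].

Lemma segnn s i : seg s i i = [::].
Proof. by rewrite /seg /index_iota subnn. Qed.

Lemma mem_seg s i j v : reflect (exists2 l, i <= l < j & v = s l) (v \in seg s i j).
Proof.
apply: (iffP mapP) => -[l]; first by rewrite mem_index_iota; exists l.
by move=> h ->; exists l; rewrite ?mem_index_iota.
Qed.

Lemma seg_split s i a b j : i <= a -> a < b -> b < j ->
  seg s i j = seg s i a ++ s a :: seg s a.+1 b ++ s b :: seg s b.+1 j.
Proof.
move=> ia ab bj; rewrite /seg /index_iota.
rewrite (_ : j - i = (a - i) + (1 + ((b - a.+1) + (1 + (j - b.+1))))); last by lia.
rewrite !iotaD !map_cat /=; congr (map _ _ ++ s _ :: _); first lia.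
rewrite (_ : i + (a - i) + 1 = a.+1); last lia.
by rewrite (_ : a.+1 + (b - a.+1) = b) ?addn1 //; lia.
Qed.

Lemma seg_path s a b : a < b -> (forall l, a <= l < b -> adj (s l) (s l.+1)) ->
  path (@adj G) (s a) (rcons (seg s a.+1 b) (s b)).
Proof.
move=> ab ss; rewrite /seg -map_rcons.
have -> : rcons (index_iota a.+1 b) b = iota a.+1 (b - a).
  by rewrite -cats1 /index_iota (_ : b - a = b - a.+1 + 1) ?iotaD; [congr (_ ++ [:: _])|]; lia.
apply/(pathP (s a)) => l; rewrite size_map size_iota => lb.
rewrite (nth_map 0) ?size_iota // nth_iota // -map_cons (nth_map 0) /= ?size_iota; last lia.
have -> : nth 0 (a :: iota a.+1 (b - a)) l = a + l.
  by case: l lb => [|l] lb /=; rewrite ?addn0 // nth_iota //; lia.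
by rewrite addSn; apply: ss; lia.
Qed.

End Cycles.

(** * Shrinking the territory *)

Section Territory.
Variable G : sgraph.
Hypothesis connG : connected_graph G.
Implicit Types (W : {set G}) (s : nat -> G) (d : G -> nat) (g h : G -> G) (T p q : seq G).

Definition boundary W (L : {pred G}) :=
  {in W, forall r v, v \notin W -> adj r v -> v \in L}.

Definition covers W g (L : {pred G}) :=
  shadow W g /\ {in W, forall r v, v \in L -> adj r v -> v = g r}.

Definition level W d :=
  {in W &, forall r r', adj r r' -> d r' = (d r).+1 \/ d r = (d r').+1}.

(* The robber's territory [W] lies on one side of the cycle formed by
   [s i .. s j] and [T].  Cops at levels [d r - 1] and [d r + 1] of [s] keep the
   robber off [s], and a single cop at [g r] keeps the robber off [T]. *)
Record fence W s i j T d g : Prop := Fence {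
  fence_lt : i < j;
  fence_conn : connected_in W;
  fence_step : forall l, step (s l) (s l.+1);
  fence_adj : forall l, i <= l < j -> adj (s l) (s l.+1);
  fence_sW : forall l, s l \notin W;
  fence_TW : {in T, forall v, v \notin W};
  fence_uniq : uniq (seg s i j.+1 ++ T);
  fence_cycle : cycle (@adj G) (seg s i j.+1 ++ T);
  fence_boundary : boundary W (mem (seg s i j.+1 ++ T));
  fence_level : level W d;
  fence_adj_level : {in W, forall r l, i <= l <= j -> adj r (s l) ->
    d r = l.+1 \/ l = (d r).+1};
  fence_covers : covers W g (mem T) }.

(** The three kinds of territory in the simultaneous induction on size: they are held by three, two
    and one cops, and the remaining cops are free to stand anywhere. *)
Definition fence_win n := forall W s i j T d g, #|W| < n -> fence W s i j T d g ->
  {in W, forall r, forall x, win [:: s (d r).-1; s (d r).+1; g r; x] r}.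

Definition cycle_win n := forall W p q h g, #|W| < n -> connected_in W -> p != [::] ->
  {in p ++ q, forall v, v \notin W} -> uniq (p ++ q) -> cycle (@adj G) (p ++ q) ->
  boundary W (mem (p ++ q)) -> covers W h (mem p) -> covers W g (mem q) ->
  {in W, forall r, forall x y, win [:: h r; g r; x; y] r}.

Definition point_win n := forall W v, #|W| < n -> connected_in W -> v \notin W ->
  boundary W (pred1 v) -> {in W, forall r, forall x y z, win [:: v; x; y; z] r}.

Lemma subset_shadow W' W g : {subset W' <= W} -> shadow W g -> shadow W' g.
Proof. by move=> sub sg r r' /sub rW /sub r'W; apply: sg. Qed.

Lemma shadow_up W s d : (forall l, step (s l) (s l.+1)) -> level W d ->
  shadow W (fun r => s (d r).+1).
Proof. by move=> ss dl r r' rW r'W /(dl _ _ rW r'W)[]->; rewrite // step_sym. Qed.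

Lemma step_pred s n : (forall l, step (s l) (s l.+1)) -> step (s n.-1) (s n).
Proof. by case: n => [|n] //= _; apply: stepxx. Qed.

Lemma shadow_down W s d : (forall l, step (s l) (s l.+1)) -> level W d ->
  shadow W (fun r => s (d r).-1).
Proof.
by move=> ss dl r r' rW r'W /(dl _ _ rW r'W)[]->; rewrite /= 1?step_sym ?step_pred // step_sym step_pred.
Qed.

(** The common shrinking step. Once [s] is guarded and the robber is off it, the vertices of [s]
    inside [W], which are those with [v = s (d v)], join the fence; [s k] witnesses that the
    territory gets smaller. *)
Lemma fence_component W s i j T d g r k :
  connected_in W -> (forall l, step (s l) (s l.+1)) -> level W d ->
  r \in W -> r != s (d r) -> s k \in W ->
  i < j -> (forall l, i <= l < j -> adj (s l) (s l.+1)) ->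
  (forall l, s l \in W -> s (d (s l)) = s l /\ i <= d (s l) <= j) ->
  (forall l, i <= l <= j -> s l \in W -> d (s l) = l) ->
  {in T, forall v, v \notin W} -> uniq (seg s i j.+1 ++ T) ->
  cycle (@adj G) (seg s i j.+1 ++ T) ->
  {in W, forall r l, i <= l <= j -> s l \notin W -> adj r (s l) -> d r = l.+1 \/ l = (d r).+1} ->
  covers W g (mem T) ->
  let W' := component (W :\: [set v | v == s (d v)]) r in
  {in W', forall u v, v \notin W -> adj u v -> v \in seg s i j.+1 ++ T} ->
  [/\ fence W' s i j T d g, r \in W' & #|W'| < #|W|].
Proof.
move=> cW ss dl rW rs skW ij sa sW sl TW uq cy al [sg gT] W' bd.
set S := [set v | v == s (d v)] in W' bd *.
have rWS : r \in W :\: S by rewrite !inE rs rW.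
have sub : {subset W' <= W}.
  by apply/subsetP; apply: subset_trans (component_sub _ _) (subsetDl _ _).
have skS : s k \in W :&: S by rewrite !inE skW (sW _ skW).1 eqxx.
have out l : s l \notin W'.
  apply/negP => slW'; have [e _] := sW l (sub _ slW').
  by move: slW'; rewrite inE => /andP[]; rewrite !inE e eqxx.
split=> //.
- split=> //.
  + exact: component_connected.
  + by move=> v /TW; apply: contra; apply: sub.
  + move=> u uW' v vW' auv; have [vW|vW] := boolP (v \in W); last exact: bd uW' v vW auv.
    have [vS|vS] := boolP (v \in S).
      rewrite inE in vS; rewrite mem_cat; apply/orP; left; apply/mem_seg.
      have e := eqP vS; exists (d v) => //.
      by have := (sW (d v)); rewrite -e => /(_ vW)[].
    by case/negP: vW'; apply: component_closed uW' _ auv; rewrite in_setD vS.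
  + by move=> u v /sub uW /sub vW; apply: dl.
  + move=> u /sub uW l ll aul; have [slW|slW] := boolP (s l \in W); last exact: al.
    by have := dl _ _ uW slW aul; rewrite sl //; case; [right|left].
  + by split; [apply: subset_shadow sg|move=> u /sub uW; apply: gT].
- exact: mem_component.
apply: proper_card; apply/properP; split; first exact/subsetP.
by exists (s k) => //; rewrite inE !inE (sW _ skW).1 eqxx.
Qed.

End Territory.

(** * Cutting a territory along a geodesic *)

Section Strategy.
Variable G : sgraph.
Hypotheses (connG : connected_graph G) (bipG : bipartite G).
Variables (rho : G -> G -> G -> bool) (sigma : rel G).
Hypothesis drawing : parity_drawing rho sigma.
Implicit Types (W : {set G}) (s : nat -> G) (d : G -> nat) (g h : G -> G) (T p q : seq G).

Lemma not_touches W' p r v : ~ touches W' p -> r \in W' -> adj r v -> v \notin p.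
Proof. by move=> nt rW arv; apply/negP => vp; apply: nt; exists v => //; exists r. Qed.

(** If [K] touched all three arcs from [a] to [b], contracting [K] would give a K_{3,3} with [a],
    [b] and [K] on one side. Hence a guard of the third arc can be released. *)
Lemma theta_arcs a b p1 p2 q (K : {set G}) : uniq (a :: b :: p1 ++ p2 ++ q) ->
  path (@adj G) a (rcons p1 b) -> path (@adj G) a (rcons p2 b) ->
  path (@adj G) b (rcons q a) -> connected_in K ->
  {in a :: b :: p1 ++ p2 ++ q, forall z, z \notin K} ->
  touches K p1 -> touches K p2 -> ~ touches K q.
Proof.
move=> uq h1 h2 /rev_arc h3 cK dis t1 t2 [m mq t3].
have pr : perm_eq (a :: b :: p1 ++ p2 ++ rev q) (a :: b :: p1 ++ p2 ++ q).
  by rewrite !perm_cons !perm_cat2l perm_rev.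
apply: (theta_free drawing _ h1 h2 h3 cK _ t1 t2); first by rewrite (perm_uniq pr).
  by move=> z; rewrite (perm_mem pr) => /dis.
by exists m; rewrite // mem_rev.
Qed.

Lemma split_cycle n W a p b q g h : fence_win G n -> #|W| <= n -> connected_in W ->
  {in a :: p ++ b :: q, forall v, v \notin W} -> uniq (a :: p ++ b :: q) ->
  cycle (@adj G) (a :: p ++ b :: q) ->
  {in W, forall r v, v \notin W -> adj r v ->
    v \in a :: p ++ b :: q /\ v \in [:: h r; g r]} ->
  covers W h (mem p) -> covers W g (mem q) ->
  (exists2 r, r \in W & adj r a) -> (exists2 r, r \in W & adj r b) ->
  {in W, forall r, forall x y, win [:: h r; g r; x; y] r}.
Proof.
move=> IH Wn cW out uq cy bd hp gq [ra raW ara] [rb rbW arb].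
have := cy; rewrite -[_ :: _]cat0s cycle_arcs cats0 => /andP[pathp pathq].
have aW : a \notin W by rewrite out // inE eqxx.
have bW : b \notin W by rewrite out // !inE mem_cat inE eqxx !orbT.
have ab : a != b by move: uq; apply: contraTneq => ->; rewrite /= mem_cat inE eqxx orbT.
pose X := [predU W & [:: a; b]].
(* Requiring an end in [W] excludes an edge between [a] and [b], so the geodesic really passes
   through [W]. *)
pose e : rel G := fun u v => [&& adj u v, u \in X, v \in X & (u \in W) || (v \in W)].
have eW u v : u \in W -> v \in W -> adj u v -> e u v.
  by move=> uW vW auv; rewrite /e auv uW !inE uW vW.
have ceW u v : u \in W -> v \in W -> connect e u v.
  move=> uW vW; apply: connect_sub (cW _ _ uW vW) => {uW vW}{}u {}v /and3P[uW vW auv].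
  exact/connect1/eW.
have esym u v : e u v -> e v u by case/and4P=> *; apply/and4P; split; rewrite 1?adj_sym // orbC.
have cea u : u \in W -> connect e a u.
  move=> uW; apply: connect_trans (ceW _ _ raW uW); apply: connect1; apply: esym.
  by rewrite /e ara raW !inE raW eqxx orbT.
have eb r : r \in W -> adj r b -> e r b.
  by move=> rW arb'; rewrite /e arb' rW !inE rW eqxx !orbT.
have ea r : r \in W -> adj r a -> e r a.
  by move=> rW arb'; rewrite /e arb' rW !inE rW eqxx !orbT.
have ceb : connect e a b by apply: connect_trans (cea _ rbW) (connect1 (eb _ rbW arb)).
have eadj : subrel e (@adj G) by move=> u v /and4P[].
have [d [s [s0 slast sedge slevel dstep]]] := geodesic bipG eadj ceb.
set N := d b in slast sedge slevel.
have sN : s N = b by apply: slast.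
have da : d a = 0 by rewrite -s0 slevel.
have N2 : 1 < N.
  case eN: N => [|[|m]] //.
    by move: ab; rewrite -s0 -sN eN eqxx.
  have := sedge 0; rewrite eN s0 => /(_ isT) /and4P[_ _ _].
  by rewrite (negPf aW) -[1]eN sN (negPf bW).
have sW l : (s l \in W) = (0 < l < N).
  have [l0|l0] := posnP l; first by rewrite l0 s0 (negPf aW).
  have [Nl|lN] := leqP N l; first by rewrite slast // (negPf bW).
  have /and4P[_ ] := sedge l lN.
  rewrite !inE => /or3P[-> //|/eqP e1|/eqP e1] _ _.
    by have := slevel l (ltnW lN); rewrite e1 da; move: l0; clear; lia.
  by have := slevel l (ltnW lN); rewrite e1 -/N; move: lN; clear; lia.
have ss l : step (s l) (s l.+1).
  have [Nl|/sedge/eadj/adj_step//] := leqP N l.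
  by rewrite !slast ?stepxx // ltnW.
have dl : level W d.
  by move=> u v uW vW auv; apply: dstep; [exact: eW|apply: eW => //; rewrite adj_sym|exact: cea].
have sWl l : s l \in W -> s (d (s l)) = s l /\ 0 <= d (s l) <= N.
  by rewrite sW => /andP[_ /ltnW lN]; rewrite slevel.
have gWx x : guards W h g (fun=> x).
  split; [exact: hp.1|exact: gq.1|exact: shadow_const|].
  by move=> u uW v vW auv; have [_] := bd u uW v vW auv; rewrite !inE => /orP[]->; rewrite ?orbT.
have gWu : guards W h g (fun r => s (d r).+1).
  split; [exact: hp.1|exact: gq.1|exact: shadow_up|].
  by move=> u uW v vW auv; have [_] := bd u uW v vW auv; rewrite !inE => /orP[]->; rewrite ?orbT.
move=> r rW x y.
(* One free cop first reaches the level above the robber; then [push] brings the other to the level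
   below. *)
apply: (chase connG (gWx x) (s := fun l => s l.+1) (d := d)) => // [u v uW vW auv|{}r {}rW].
  by case: (dl _ _ uW vW auv); clear; lia.
apply: win_swap34.
apply: (push connG gWu) => // {rW}r rW rs.
set arc := seg s 1 N.
have segE : seg s 0 N.+1 = a :: arc ++ [:: b].
  by rewrite (@seg_split _ s 0 0 N N.+1) // 1?ltnW // !segnn s0 sN.
have arcW : {in arc, forall v, v \in W} by move=> v /mem_seg[l ll ->]; rewrite sW.
have uarc : uniq arc.
  rewrite map_inj_in_uniq ?iota_uniq // => l l'; rewrite !mem_index_iota => ll ll' e1.
  by rewrite -(slevel l) ?e1 ?slevel //; move: ll ll'; clear; lia.
have parc : path (@adj G) a (rcons arc b).
  rewrite -s0 -sN; apply: seg_path; first exact: ltnW.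
  by move=> l ll; apply: eadj; apply: sedge; move: ll; clear; lia.
have fresh z : z \in arc -> z \notin a :: p ++ b :: q.
  by move=> /arcW zW; apply/negP => /out; rewrite zW.
have comp T f : covers W f (mem T) -> {in T, forall v, v \notin W} ->
    uniq (a :: arc ++ b :: T) -> path (@adj G) b (rcons T a) ->
    let W' := component (W :\: [set v | v == s (d v)]) r in
    {in W', forall u v, v \notin W -> adj u v -> v \in a :: arc ++ b :: T} ->
    [/\ fence W' s 0 N T d f, r \in W' & #|W'| < #|W|].
  move=> cf TW uT pT /= bdT; have segT : seg s 0 N.+1 ++ T = a :: arc ++ b :: T.
    by rewrite segE /= -catA.
  apply: (@fence_component _ W s 0 N T d f r 1) => //; rewrite ?segT //.
  - by rewrite sW.
  - exact: ltnW.
  - by move=> l ll; apply: eadj; apply: sedge; move: ll; clear; lia.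
  - by move=> l ll _; apply: slevel; case/andP: ll.
  - by rewrite -[_ :: _]cat0s cycle_arcs cats0 parc.
  move=> u uW l ll slW aul.
  have [cu cs] : connect e a u /\ (e u (s l)).
    split; first exact: cea.
    move: slW; rewrite sW negb_and -leqNgt leqn0 -leqNgt => /orP[/eqP l0|Nl].
      by rewrite l0 s0; apply: ea; rewrite -?s0 -?l0.
    by rewrite slast //; apply: eb; rewrite // -(slast l).
  have := dstep _ _ cs (esym _ _ cs) cu; rewrite slevel; last by case/andP: ll.
  by case=> ->; [right|left].
set S := [set v | v == s (d v)] in comp; set W' := component (W :\: S) r in comp.
have sub : {subset W' <= W}.
  by apply/subsetP; apply: subset_trans (component_sub _ _) (subsetDl _ _).
have rWS : r \in W :\: S by rewrite !inE rs rW.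
(* [W] is connected and contains [s 1], so the component of [r] has a neighbor on the geodesic. *)
have tS : touches W' arc.
  have s1S : s 1 \in W :&: S by rewrite !inE sW N2 slevel ?eqxx // ltnW.
  have [u [v [uW' /setIP[vW vS] auv]]] := component_exit cW rWS s1S.
  rewrite inE in vS; exists v; last by exists u.
  apply/mem_seg; exists (d v); last exact/eqP.
  by rewrite -sW -(eqP vS).
have uqa : uniq (a :: b :: p ++ arc ++ q).
  have : uniq ((a :: p ++ b :: q) ++ arc).
    by rewrite cat_uniq uq uarc andbT; apply/hasPn => z /fresh.
  by rewrite (perm_uniq (perm_arcs _ _ _ _ _)).
have outa : {in a :: b :: p ++ arc ++ q, forall z, z \notin W'}.
  move=> z zl; have [za|za] := boolP (z \in arc).
    move/mem_seg: za => [l ll ->]; rewrite inE !inE slevel ?eqxx //.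
    by move: ll; clear; lia.
  apply: (contra (@sub z)); apply: out; move: zl; rewrite !(inE, mem_cat) (negPf za) /=.
  by case/or4P=> ->; rewrite ?orbT.
have cW' : connected_in W' by apply: component_connected.
(* The new territory touches the geodesic, hence not both [p] and [q]. If it touches [p], the cop at
   [g r] becomes free, otherwise the one at [h r]. *)
have [tp|ntp] := boolp.pselect (touches W' p).
  have ntq := theta_arcs uqa pathp parc pathq cW' outa tp tS.
  case: (comp (rev p) h).
  - split=> [|u uW v vp]; first exact: hp.1.
    by apply: hp.2 => //; rewrite -[in_mem _ _]/(v \in p) -mem_rev.
  - by move=> v; rewrite mem_rev => vp; apply: out; rewrite inE mem_cat vp !orbT.
  - by move: uqa; rewrite -(perm_uniq (perm_arcs_rev _ _ _ _ _)) cat_uniq => /andP[].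
  - exact: rev_arc.
  - move=> u uW' v vW auv; have [vl _] := bd u (sub _ uW') v vW auv.
    have := not_touches ntq uW' auv; move: vl; rewrite !(inE, mem_cat) mem_rev.
    by case/or4P=> ->; rewrite ?orbT.
  move=> fW' rW' lt.
  have w := IH _ _ _ _ _ _ _ (leq_trans lt Wn) fW' r rW' (g r).
  exact/win_swap12/win_rev.
case: (comp q g) => //.
- by move=> v vq; apply: out; rewrite inE mem_cat inE vq !orbT.
- by move: uqa; rewrite -(perm_uniq (perm_arcs_r _ _ _ _ _)) cat_uniq => /andP[].
- move=> u uW' v vW auv; have [vl _] := bd u (sub _ uW') v vW auv.
  have := not_touches ntp uW' auv; move: vl; rewrite !(inE, mem_cat).
  by case/or4P=> ->; rewrite ?orbT.
move=> fW' rW' lt.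
have w := IH _ _ _ _ _ _ _ (leq_trans lt Wn) fW' r rW' (h r).
exact: win_rev.
Qed.

End Strategy.

Section Steps.
Variable G : sgraph.
Hypotheses (connG : connected_graph G) (bipG : bipartite G).
Variables (rho : G -> G -> G -> bool) (sigma : rel G).
Hypothesis drawing : parity_drawing rho sigma.
Implicit Types (W : {set G}) (s : nat -> G) (d : G -> nat) (g h : G -> G) (T p q : seq G).

Lemma point_step n : fence_win G n -> point_win G n -> point_win G n.+1.
Proof.
move=> IHf IHp W v; rewrite ltnS => Wn cW vW bd.
have gv f2 f3 : shadow W f2 -> shadow W f3 -> guards W (fun=> v) f2 f3.
  move=> s2 s3; split=> //; first exact: shadow_const.
  by move=> u uW w wW auw; rewrite (eqP (bd u uW w wW auw)) inE eqxx.
(* If [v] has two neighbors in [W], a geodesic between them inside [W] closes to a cycle through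
   [v], and the resulting fence has [T = [:: v]]. *)
have [[w1 [w2 [w1W w2W a1 a2 w12]]]|nw] := boolp.pselect (exists w1 w2,
    [/\ w1 \in W, w2 \in W, adj v w1, adj v w2 & w1 != w2]).
  have eadj : subrel (induced W) (@adj G) by move=> u w /and3P[].
  have [d [s [s0 slast sedge slevel dstep]]] := geodesic bipG eadj (cW _ _ w1W w2W).
  set N := d w2 in slast sedge slevel.
  have sN : s N = w2 by apply: slast.
  have N0 : 0 < N.
    by rewrite lt0n; apply: contraNneq w12 => eN; rewrite -sN eN s0.
  have sW l : s l \in W.
    by have [Nl|/sedge/and3P[]//] := leqP N l; rewrite slast.
  have ss l : step (s l) (s l.+1).
    have [Nl|/sedge/eadj/adj_step//] := leqP N l.
    by rewrite !slast ?stepxx // ltnW.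
  have dl : level W d.
    move=> u w uW wW auw; apply: dstep; last exact: cW.
      by rewrite /induced uW wW.
    by rewrite /induced uW wW adj_sym.
  move=> r rW x y z.
  have gx := gv _ _ (@shadow_const _ W x) (@shadow_const _ W y).
  apply: (chase connG gx (s := fun l => s l.+1) (d := d)) => // [u w uW wW auw|{}r {}rW].
    by case: (dl _ _ uW wW auw); clear; lia.
  have gu := gv _ _ (@shadow_const _ W x) (shadow_up ss dl).
  apply/win_swap34; apply: (push connG gu) => // {rW}r rW rs.
  have segE : seg s 0 N.+1 = w1 :: seg s 1 N ++ [:: w2].
    by rewrite (@seg_split _ s 0 0 N N.+1) // !segnn s0 sN.
  have useg : uniq (seg s 0 N.+1).
    rewrite map_inj_in_uniq ?iota_uniq // => l l'; rewrite !mem_index_iota => ll ll' e1.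
    by rewrite -(slevel l) ?e1 ?slevel //; move: ll ll'; clear; lia.
  case: (@fence_component _ W s 0 N [:: v] d (fun=> v) r 0) => //.
  - by move=> l ll; apply: eadj; apply: sedge; case/andP: ll.
  - move=> l _; have [Nl|/ltnW lN] := leqP N l; last by rewrite slevel.
    by rewrite (slast _ Nl) -/N sN leqnn.
  - by move=> l ll _; apply: slevel; case/andP: ll.
  - by move=> u; rewrite inE => /eqP->.
  - rewrite cat_uniq useg /= orbF andbT; apply/negP => /mem_seg[l _ e].
    by move: vW; rewrite e sW.
  - have -> : seg s 0 N.+1 ++ [:: v] = [::] ++ w1 :: seg s 1 N ++ w2 :: [:: v].
      by rewrite segE /= -catA.
    rewrite cycle_arcs /= adj_sym a2 a1 !andbT.
    rewrite -s0 -sN; apply: seg_path => // l ll; apply: eadj; apply: sedge.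
    by case/andP: ll.
  - by move=> u uW l _; rewrite sW.
  - split; first exact: shadow_const.
    by move=> u uW w; rewrite inE => /eqP.
  - move=> u uW' w wW auw.
    have uW : u \in W by move: uW'; rewrite inE => /andP[]; rewrite inE => /andP[].
    by rewrite (eqP (bd u uW w wW auw)) mem_cat mem_head orbT.
  move=> fW' rW' lt.
  exact/win_rev/win_swap34/(IHf _ _ _ _ _ _ _ (leq_trans lt Wn) fW' r rW').
move=> r rW x y z.
(* At most one neighbor [w] of [v] lies in [W]; without any, [w] is arbitrary. A free cop goes to
   [w], which then takes over the role of [v]. *)
have [w wW wP] : exists2 w, w \in W & {in W, forall u, adj u v -> u = w}.
  have [[w /andP[wW aw]]|no] := boolp.pselect (exists w, (w \in W) && adj v w).
    exists w => // u uW auv; apply/eqP/negPn/negP => uw; apply: nw.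
    by exists u, w; rewrite adj_sym.
  by exists r => // u uW auv; case: no; exists u; rewrite uW adj_sym.
have gx := gv _ _ (@shadow_const _ W x) (@shadow_const _ W y).
apply: (chase connG gx (s := fun=> w) (d := fun=> 0)) => // [l|{rW}r rW].
  exact: stepxx.
apply: (win_confined gx) => // r' r'W _; rewrite !inE !negb_or => /and4P[_ _ _ r'w].
exists w; first exact: stepxx.
set W' := component (W :\ w) r'.
have r'Ww : r' \in W :\ w by rewrite !inE r'w.
have sub : {subset W' <= W :\ w} by apply/subsetP/component_sub.
have lt : #|W'| < n.
  apply: leq_trans _ Wn; apply: proper_card; apply/properP; split.
    by apply/subsetP => u /sub; rewrite inE => /andP[].
  by exists w => //; apply/negP => /sub; rewrite !inE eqxx.
apply/win_rev; apply: (IHp W' w) => //; first exact: component_connected.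
- by apply/negP => /sub; rewrite !inE eqxx.
- move=> u uW' t tW' aut; rewrite inE; apply: contraNT tW' => tw.
  have /setD1P[uw uW] := sub _ uW'.
  have [tW|tW] := boolP (t \in W).
    by apply: component_closed uW' _ aut; rewrite !inE tw.
  have tv := bd u uW t tW aut; rewrite (eqP tv) in aut.
  by rewrite (wP u uW aut) eqxx in uw.
exact: mem_component.
Qed.

Lemma cycle_catC p q : cycle (@adj G) (p ++ q) = cycle (@adj G) (q ++ p).
Proof. by rewrite -(rot_cycle (size p)) rot_size_cat. Qed.

(** The cycle is cut at two vertices with neighbors in [W], chosen so that all exits on each open
    arc belong to a single guard. *)
Lemma cycle_step n : fence_win G n -> point_win G n.+1 -> cycle_win G n.+1.
Proof.
move=> IHf IHp W p q h g; rewrite ltnS => Wn cW pn out uq cy bd hp gq.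
pose nb v := [exists r in W, adj r v].
have nbP v : reflect (exists2 r, r \in W & adj r v) (nb v) by apply: exists_inP.
have nohas r v p0 : ~~ has nb p0 -> r \in W -> adj r v -> v \notin p0.
  by move=> /hasPn ns rW arv; apply/negP => /ns /nbP[]; exists r.
have covered p' f : covers W f (mem p') -> forall p0 p1, {subset p1 <= p0 ++ p'} ->
    ~~ has nb p0 -> covers W f (mem p1).
  move=> [sf cf] p0 p1 sub n0; split=> // r rW v /sub; rewrite mem_cat.
  case/orP=> [vp0|vp'] arv; last exact: cf.
  by have := nohas r v p0 n0 rW arv; rewrite vp0.
have split a p1 b q1 f f' : perm_eq (a :: p1 ++ b :: q1) (p ++ q) ->
    cycle (@adj G) (a :: p1 ++ b :: q1) -> nb a -> nb b ->
    (forall r, perm_eq [:: f r; f' r] [:: h r; g r]) ->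
    covers W f (mem p1) -> covers W f' (mem q1) ->
    {in W, forall r, forall x y, win [:: f r; f' r; x; y] r}.
  move=> pr cy' /nbP na /nbP nb' hg cf cf'.
  apply: (split_cycle connG bipG drawing IHf Wn cW _ _ cy') => //.
  - by move=> v; rewrite (perm_mem pr); apply: out.
  - by rewrite (perm_uniq pr).
  - move=> r rW v vW arv; have vl := bd r rW v vW arv.
    split; first by rewrite (perm_mem pr).
    move: vl; rewrite (perm_mem (hg r)) -[in_mem _ _]/(v \in p ++ q) mem_cat => /orP[vp|vq].
      by rewrite (hp.2 r rW v vp arv) inE eqxx.
    by rewrite (gq.2 r rW v vq arv) !inE eqxx orbT.
move=> r rW x y.
(* The cuts are the first and the last exit on [p]. The exits on the arc outside them then all lie
   on [q], and similarly with [p] and [q] exchanged. *)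
have [cp|cp] := ltnP 1 (count nb p).
  have [p0 [a [p1 [b [p2 [e na nb' n0 n2]]]]]] := split_first_last cp.
  apply: (split a p1 b (p2 ++ q ++ p0)) => //.
  - by rewrite perm_sym e; apply/permP => P; rewrite /= !count_cat /= !count_cat /=; clear; lia.
  - have -> : a :: p1 ++ b :: p2 ++ q ++ p0 = ((a :: p1 ++ b :: p2) ++ q) ++ p0.
      by rewrite !(cat_cons, =^~ catA).
    by rewrite cycle_catC catA -e.
  - by apply: (covered _ _ hp [::]) => // v; rewrite e !(inE, mem_cat) => ->; rewrite !orbT.
  - apply: (covered _ _ gq (p2 ++ p0)); last by rewrite has_cat negb_or n2.
    by move=> v; rewrite !mem_cat; case: (v \in p2) (v \in q) (v \in p0) => [] [] [].
have [cq|cq] := ltnP 1 (count nb q).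
  have [q0 [a [q1 [b [q2 [e na nb' n0 n2]]]]]] := split_first_last cq.
  apply: win_swap12; apply: (split a q1 b (q2 ++ p ++ q0)) => //.
  - by rewrite e; apply/permP => P; rewrite /= !count_cat /= !count_cat /=; clear; lia.
  - have -> : a :: q1 ++ b :: q2 ++ p ++ q0 = ((a :: q1 ++ b :: q2) ++ p) ++ q0.
      by rewrite !(cat_cons, =^~ catA).
    by rewrite cycle_catC catA -e cycle_catC.
  - by move=> u; rewrite (perm_catC [:: g u] [:: h u]).
  - by apply: (covered _ _ gq [::]) => // v; rewrite e !(inE, mem_cat) => ->; rewrite !orbT.
  - apply: (covered _ _ hp (q2 ++ q0)); last by rewrite has_cat negb_or n2.
    by move=> v; rewrite !mem_cat; case: (v \in q2) (v \in p) (v \in q0) => [] [] [].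
have single p0 : has nb p0 -> count nb p0 <= 1 ->
    exists p1 a p2, [/\ p0 = p1 ++ a :: p2, nb a & ~~ has nb (p1 ++ p2)].
  move=> /split_first[p1 [a [p2 [-> na n1]]]]; rewrite count_cat /= na => c1.
  exists p1, a, p2; split=> //; rewrite has_count count_cat; move: c1; clear; lia.
(* With a single exit [v0], a free cop goes there. The territory is unchanged, which is why
   [point_win] is taken at [n.+1]. *)
have one v0 : v0 \notin W -> (forall u v, u \in W -> adj u v -> v \in p ++ q -> v = v0) ->
    win [:: h r; g r; x; y] r.
  move=> v0W all1; have gx : guards W h g (fun=> x).
    split; [exact: hp.1|exact: gq.1|exact: shadow_const|].
    move=> u uW v vW auv; have := bd u uW v vW auv.
    rewrite -[in_mem _ _]/(v \in p ++ q) mem_cat => /orP[vp|vq].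
      by rewrite (hp.2 u uW v vp auv) inE eqxx.
    by rewrite (gq.2 u uW v vq auv) !inE eqxx orbT.
  apply: (chase connG gx (s := fun=> v0) (d := fun=> 0)) => // [l|{rW}r rW].
    exact: stepxx.
  apply/win_rev; apply: (IHp W) => // u uW v vW auv.
  by rewrite inE; apply/eqP; apply: (all1 u) => //; apply: bd vW auv.
have one' p0 p' : {subset p0 ++ p' <= p ++ q} -> {subset p ++ q <= p0 ++ p'} ->
    ~~ has nb p0 -> count nb p' <= 1 -> win [:: h r; g r; x; y] r.
  move=> sub sub' n0 c1; have [/(single _)/(_ c1)[p1 [a [p2 [e na n12]]]]|n'] := boolP (has nb p').
    apply: (one a); first by apply: out; apply: sub; rewrite e !mem_cat inE eqxx !orbT.
    move=> u v uW auv /sub'; rewrite e mem_cat => /orP[vp|].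
      by have := nohas u v p0 n0 uW auv; rewrite vp.
    have := nohas u v _ n12 uW auv.
    by rewrite !mem_cat inE orbCA; case: eqP => //= _ /negPf->.
  (* There is no exit at all; any vertex of the nonempty [p] serves as [v0]. *)
  have [v0 v0p] : exists v, v \in p by case: (p) pn => // v p1 _; exists v; rewrite inE eqxx.
  have nn u v : u \in W -> adj u v -> v \notin W -> False.
    move=> uW auv vW; have := sub' _ (bd u uW v vW auv); rewrite mem_cat.
    by rewrite (negPf (nohas u v _ n0 uW auv)) (negPf (nohas u v _ n' uW auv)).
  apply: (one v0) => [|u v uW auv vl]; first by apply: out; rewrite mem_cat v0p.
  by case: (nn u v) => //; apply: out.
have [hasp|nhp] := boolP (has nb p); last by apply: (one' p q).
have [hasq|nhq] := boolP (has nb q); last first.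
  by apply: (one' q p) => // v; rewrite !mem_cat orbC.
(* One exit on each of [p] and [q]: cutting at both leaves no exit in the open arcs. *)
have [p1 [a [p2 [ep na np]]]] := single _ hasp cp.
have [q1 [b [q2 [eq nb' nq]]]] := single _ hasq cq.
apply: (split a (p2 ++ q1) b (q2 ++ p1)) => //.
- by rewrite ep eq; apply/permP => P; rewrite /= !count_cat /= !count_cat /=; clear; lia.
- have -> : a :: (p2 ++ q1) ++ b :: q2 ++ p1 = ((a :: p2) ++ (q1 ++ b :: q2)) ++ p1.
    by rewrite !(cat_cons, =^~ catA).
  by rewrite cycle_catC catA -ep -eq.
- apply: (covered _ _ hp (q1 ++ q2)) => // v; rewrite ep !(mem_cat, inE).
  by case/orP => ->; rewrite ?orbT.
apply: (covered _ _ gq (p1 ++ p2)) => // v; rewrite eq !(mem_cat, inE).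
by case/orP => ->; rewrite ?orbT.
Qed.

End Steps.

(** * Detours and guarding a geodesic with one cop *)

Section Detours.
Variables (G : sgraph) (W : {set G}) (s : nat -> G) (i j : nat) (d : G -> nat).
Hypothesis ss : forall l, step (s l) (s l.+1).
Hypothesis dl : level W d.
Hypothesis sl : {in W, forall r l, i <= l <= j -> adj r (s l) -> d r = l.+1 \/ l = (d r).+1}.

Definition upward : rel G := fun u v => [&& u \in W, v \in W, adj u v & d v == (d u).+1].

(* A monotone path through [W] from [s a], just below [r], to [s b], just above [w]. *)
Definition detour a b r w : Prop :=
  [/\ i <= a, b <= j, r \in W, adj r (s a) & d r = a.+1] /\
  [/\ connect upward r w, adj w (s b) & b = (d w).+1].

(** Each step of [upward] raises the level by one, so the walk can be indexed by level, as splicing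
    it into [s] requires. *)
Lemma upward_walk r w : r \in W -> connect upward r w -> exists t : nat -> G,
  [/\ t (d r) = r, t (d w) = w, d r <= d w,
      forall l, d r <= l <= d w -> t l \in W /\ d (t l) = l &
      forall l, d r <= l < d w -> adj (t l) (t l.+1)].
Proof.
move=> rW /connectP[p]; elim/last_ind: p w => [|p z IH] w /=.
  move=> _ ->; exists (fun=> r); split=> // l; rewrite ?ltnNge ?andbN // -eqn_leq.
  by move/eqP=> <-.
rewrite rcons_path last_rcons => /andP[pp /and4P[lW zW alz /eqP dz]] ->.
have [t [t1 t2 t3 t4 t5]] := IH _ pp erefl.
exists (fun l => if l <= d (last r p) then t l else z); rewrite dz t3 ltnn.
split=> //; first exact: leqW.
  move=> l; case: (leqP l (d (last r p))) => [ll /andP[rl _]|ll lz]; first by apply: t4; rewrite rl.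
  by split=> //; rewrite dz; move: lz ll; clear; lia.
move=> l /andP[rl]; rewrite ltnS => ll; rewrite ll.
case: ltnP => [lt|ge]; first by apply: t5; rewrite rl.
by rewrite (_ : l = d (last r p)) ?t2 //; apply/eqP; rewrite eqn_leq ll.
Qed.

(* Below the top of the first detour a single cop guards [s]: above a robber who
   can still climb to [s] through [W], and below any other robber. *)
Definition climbs b r : bool := boolp.asbool (exists w l,
  [/\ connect upward r w, i <= l < b, adj w (s l) & l = (d w).+1]).

Definition half_guard b r : G := if climbs b r then s (d r).+1 else s (d r).-1.

(** On an upward move the cop would have to jump only when switching from below to above. This
    cannot happen, since [climbs] passes from the upper vertex down to the lower one. *)
Lemma half_guard_shadow b : shadow W (half_guard b).
Proof.
have up r r' : r \in W -> r' \in W -> adj r r' -> d r' = (d r).+1 ->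
    step (half_guard b r) (half_guard b r').
  move=> rW r'W a e; rewrite /half_guard.
  have [/boolp.asboolP[w [l [c1 c2 c3 c4]]]|nF] := boolP (climbs b r').
    rewrite (_ : climbs b r) ?e //; apply/boolp.asboolP; exists w, l; split=> //.
    by apply: connect_trans (connect1 _) c1; rewrite /upward rW r'W a e eqxx.
  by rewrite e; case: ifP => _ /=; [rewrite step_sym|rewrite step_pred].
by move=> r r' rW r'W a; case: (dl rW r'W a) => e; [|rewrite step_sym]; apply: up; rewrite // adj_sym.
Qed.

Variable b : nat.
Hypotheses (bj : b <= j.+1) (bmin : forall a b' r w, detour a b' r w -> b <= b').

(** A robber next to [s l] from above who could still climb to [s] below [b] would complete a detour
    ending below [b], against minimality; so the cop is below him. *)
Lemma half_guard_lower r l : r \in W -> i <= l <= j -> adj r (s l) -> d r = l.+1 -> half_guard b r = s l.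
Proof.
move=> rW ll a e; rewrite /half_guard; case: ifP => [/boolp.asboolP[w [l' [c1 c2 c3 c4]]]|_].
  have : b <= l' by apply: (bmin (a := l) (r := r) (w := w)); split; split=> //; lia.
  lia.
by rewrite e.
Qed.

Lemma half_guard_upper r l : i <= l < b -> adj r (s l) -> l = (d r).+1 -> half_guard b r = s l.
Proof.
move=> ll a e; rewrite /half_guard ifT ?e //; apply/boolp.asboolP; exists r, l; split=> //.
Qed.

Lemma half_guard_covers (L : {pred G}) :
  {in L, forall v, exists2 l, i <= l <= j /\ l < b & v = s l} -> covers W (half_guard b) L.
Proof.
move=> Ls; split=> [|r rW v /Ls[l [lj lb] ->] arl]; first exact: half_guard_shadow.
have [e|e] := sl rW lj arl; first by rewrite (half_guard_lower rW lj).
by rewrite (half_guard_upper _ arl e) // lb andbT; case/andP: lj.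
Qed.

End Detours.

Section FenceStep.
Variable G : sgraph.
Hypotheses (connG : connected_graph G) (bipG : bipartite G).
Variables (rho : G -> G -> G -> bool) (sigma : rel G).
Hypothesis drawing : parity_drawing rho sigma.
Implicit Types (W : {set G}) (s : nat -> G) (d : G -> nat) (g h : G -> G) (T p q : seq G).

Lemma eq_seg s s' i j : (forall l, i <= l < j -> s l = s' l) -> seg s i j = seg s' i j.
Proof. by move=> e; apply/eq_in_map => l; rewrite mem_index_iota; apply: e. Qed.

Lemma fence_guards W s i j T d g : fence W s i j T d g ->
  guards W (fun r => s (d r).-1) (fun r => s (d r).+1) g.
Proof.
move=> F; have ss := fence_step F; have dl := fence_level F.
split; [exact: shadow_down|exact: shadow_up|exact: (fence_covers F).1|].
move=> r rW v vW arv; have := fence_boundary F rW vW arv.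
rewrite -[in_mem _ _]/(v \in _ ++ _) mem_cat => /orP[/mem_seg[l ll e]|vT].
  rewrite e in arv *; case: (fence_adj_level F rW ll arv) => ->; rewrite /= !inE eqxx ?orbT //.
by rewrite ((fence_covers F).2 r rW v vT arv) !inE eqxx !orbT.
Qed.

(** Here [s'] is [s] with its stretch strictly between [a] and [b] rerouted along the detour, level
    by level. *)
Lemma splice W s i j T d g a b r1 w1 : fence W s i j T d g ->
  detour W s i j d a b r1 w1 -> exists s',
  [/\ forall l, step (s' l) (s' l.+1), forall l, i <= l < j -> adj (s' l) (s' l.+1),
      forall l, (s' l \in W) = (a < l < b), forall l, a < l < b -> d (s' l) = l &
      forall l, ~~ (a < l < b) -> s' l = s l].
Proof.
move=> F [[ia bj r1W a1 d1] [c1 a2 d2]].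
have [t [t1 t2 t3 t4 t5]] := upward_walk r1W c1.
rewrite d1 in t1 t3 t4 t5.
pose s' l := if a < l < b then t l else s l.
have on l : a < l < b -> t l \in W /\ d (t l) = l.
  by move=> ll; apply: t4; move: ll; rewrite d2 ltnS.
have s'adj l : a <= l < b -> adj (s' l) (s' l.+1).
  rewrite /s' leq_eqVlt ltnS => /andP[/predU1P[<-|al] lb].
    by rewrite ltnn leqnn /= d2 ltnS t3 t1 adj_sym.
  rewrite al lb (ltnW al) /=; have [lb'|] := boolP (l.+1 < b).
    by apply: t5; rewrite al -ltnS -d2.
  rewrite -leqNgt => bl; have e : b = l.+1 by apply/eqP; rewrite eqn_leq bl lb.
  by move: d2; rewrite e => -[el]; rewrite -e {1}el t2.
have out l : ~~ (a <= l < b) -> s' l = s l /\ s' l.+1 = s l.+1.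
  by move=> nl; rewrite /s' !ifF //; apply/negbTE; move: nl; clear; lia.
exists s'; split.
- move=> l; have [ll|/out[-> ->]] := boolP (a <= l < b); first exact/adj_step/s'adj.
  exact: (fence_step F).
- move=> l lij; have [ll|/out[-> ->]] := boolP (a <= l < b); first exact: s'adj.
  exact: (fence_adj F).
- move=> l; rewrite /s'; case: ifP => [/on[]//|_]; exact/negbTE/(fence_sW F).
- by move=> l ll; rewrite /s' ll; have [] := on l ll.
- by move=> l ll; rewrite /s' (negPf ll).
Qed.

Lemma fence_win_step n : fence_win G n -> cycle_win G n.+1 -> fence_win G n.+1.
Proof.
move=> IHf IHc W s i j T d g; rewrite ltnS => Wn F r rW x.
have [ij cW ss sadj sW TW uq cy bd dl al gT] := F.
have hf b u : half_guard W s i d b u = s (d u).+1 \/ half_guard W s i d b u = s (d u).-1.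
  by rewrite /half_guard; case: ifP; [left|right].
have [[b0 D0]|noD] := boolp.pselect (exists b, exists a r w, detour W s i j d a b r w); last first.
  (* Without detours the bound [j.+1] makes the half guard cover all of [s i .. s j]. The other cop
     of [s] is free, and the same [W] is handed to [cycle_win]. *)
  have bmin : forall a b' r w, detour W s i j d a b' r w -> j.+1 <= b'.
    by move=> a b' r' w D; case: noD; exists b', a, r', w.
  have hc : covers W (half_guard W s i d j.+1) (mem (seg s i j.+1)).
    apply: (half_guard_covers ss dl al (leqnn _) bmin) => v /mem_seg[l ll ->]; exists l => //; split=> //.
    by case/andP: ll.
  have w y z : win [:: half_guard W s i d j.+1 r; g r; y; z] r.
    apply: (IHc W (seg s i j.+1) T) => //.
      by rewrite (@seg_split _ s i i j) // ?segnn //; exact: leq_trans ij (leqnn _).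
    move=> v; rewrite mem_cat => /orP[/mem_seg[l _ ->]|/TW//]; exact: sW.
  have [e|e] := hf j.+1 r; rewrite e in w.
    exact/win_swap12/win_swap23/w.
  exact/win_swap23/w.
have [b [[a [r1 [w1 D]]] bmin]] : exists b, (exists a r w, detour W s i j d a b r w) /\
    forall a b' r w, detour W s i j d a b' r w -> b <= b'.
  pose P b := boolp.asbool (exists a r w, detour W s i j d a b r w).
  have exP : exists b, P b by exists b0; apply/boolp.asboolP.
  case: (ex_minnP exP) => b /boolp.asboolP Db bmin; exists b; split=> // a b' r' w D.
  by apply: bmin; apply/boolp.asboolP; exists a, r', w.
have [[ia bj _ _ dr1] [cr1 _ bw1]] := D.
have bj1 : b <= j.+1 := leqW bj.
have ab : a.+1 < b.
  have r1W : r1 \in W by case: D => -[].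
  have [t [_ _ le _ _]] := upward_walk r1W cr1.
  by rewrite bw1 ltnS -dr1.
have ab' : a < b := ltnW ab.
have [s' [ss' sadj' sW' ds' es']] := splice F D.
set h := half_guard W s i d b.
(* The half guard misses only exits upward to levels at least [b], where [s'] agrees with [s]; the
   cop above the robber on [s'] occupies these. *)
have hup l u : u \in W -> i <= l <= j -> adj u (s l) -> h u = s l \/ s' (d u).+1 = s l.
  move=> uW ll aul; have [e|e] := al u uW l ll aul.
    by left; apply: (half_guard_lower bj1 bmin uW ll).
  have [lb|bl] := ltnP l b.
    by left; apply: half_guard_upper aul e; case/andP: ll => ->.
  by right; rewrite -e es' // negb_and -!leqNgt bl orbT.
have gU : guards W h g (fun u => s' (d u).+1).
  split; [exact: half_guard_shadow|exact: gT.1|exact: shadow_up|].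
  move=> u uW v vW auv; have := bd u uW v vW auv.
  rewrite -[in_mem _ _]/(v \in _ ++ _) mem_cat => /orP[/mem_seg[l ll e]|vT].
    by rewrite e in auv *; case: (hup l u uW ll auv) => ->; rewrite !inE eqxx ?orbT.
  by rewrite (gT.2 u uW v vT auv) !inE eqxx orbT.
(* While the old guards hold, the fourth cop settles above the robber's level on [s']. *)
apply: (chase connG (fence_guards F) (s := fun l => s' l.+1) (d := d)) => //.
  by move=> u v uW vW auv; case: (dl _ _ uW vW auv); clear; lia.
move=> {rW}r rW.
(* The half guard stands at one of [s (d r).+1] and [s (d r).-1], so the cop at the other one is
   released. *)
have {x} pushed : forall x, win [:: h r; g r; s' (d r).+1; x] r; last first.
  have [e|e] := hf b r; rewrite -/h in e.
    by have := pushed (s (d r).-1); rewrite e => /win_rot.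
  by have := pushed (s (d r).+1); rewrite e => /win_swap34/win_swap23.
move=> z; apply: (push connG gU) => // {z rW}r rW rs.
set Y := seg s i a; set X := seg s b.+1 j.+1.
set arc := seg s a.+1 b; set arc' := seg s' a.+1 b; set rest := (X ++ T) ++ Y.
have segE : seg s i j.+1 = Y ++ s a :: arc ++ s b :: X by apply: seg_split.
have s'a : s' a = s a by apply: es'; rewrite ltnn.
have s'b : s' b = s b by apply: es'; rewrite ltnn andbF.
have segE' : seg s' i j.+1 = Y ++ s a :: arc' ++ s b :: X.
  rewrite (@seg_split _ s' i a b j.+1) // s'a s'b; congr (_ ++ _ :: _ ++ _ :: _); apply: eq_seg => l ll.
    by apply: es'; move: ll; clear; lia.
  by apply: es'; move: ll; clear; lia.
have segab : seg s' a b.+1 = s a :: arc' ++ [:: s b].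
  by rewrite (@seg_split _ s' a a b b.+1) // !segnn s'a s'b.
have segT : seg s i j.+1 ++ T = Y ++ s a :: arc ++ s b :: (X ++ T).
  by rewrite segE !(cat_cons, =^~ catA).
have segT' : seg s' i j.+1 ++ T = Y ++ s a :: arc' ++ s b :: (X ++ T).
  by rewrite segE' !(cat_cons, =^~ catA).
have := cy; rewrite segT cycle_arcs => /andP[pathp pathq].
have parc' : path (@adj G) (s a) (rcons arc' (s b)).
  rewrite -s'a -s'b; apply: seg_path => // l ll; apply: sadj'.
  by move: ll ia bj; clear; lia.
have outc v : v \in seg s i j.+1 ++ T -> v \notin W.
  by rewrite mem_cat => /orP[/mem_seg[l _ ->]|/TW//]; apply: sW.
have permc : perm_eq (seg s i j.+1 ++ T) (s a :: arc ++ s b :: rest).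
  by rewrite segT perm_rot_arcs.
have arcW v : v \in arc' -> v \in W by move=> /mem_seg[l ll ->]; rewrite sW'.
have uarc : uniq arc'.
  rewrite map_inj_in_uniq ?iota_uniq // => l l'; rewrite !mem_index_iota => ll ll' e.
  by rewrite -(ds' l ll) e ds'.
have uqa : uniq (s a :: s b :: arc ++ arc' ++ rest).
  rewrite -(perm_uniq (perm_arcs _ _ _ _ _)) cat_uniq -(perm_uniq permc) uq uarc andbT.
  apply/hasPn => z /arcW zW; rewrite /= -(perm_mem permc); apply/negP => /outc.
  by rewrite zW.
set S := [set v | v == s' (d v)]; set W' := component (W :\: S) r.
have sub : {subset W' <= W}.
  by apply/subsetP; apply: subset_trans (component_sub _ _) (subsetDl _ _).
have rWS : r \in W :\: S by rewrite !inE rs rW.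
have aW : s' a.+1 \in W by rewrite sW' ltnSn ab.
have tS : touches W' arc'.
  have s1S : s' a.+1 \in W :&: S by rewrite !inE aW ds' ?eqxx // ltnSn ab.
  have [u [v [uW' /setIP[vW vS] auv]]] := component_exit cW rWS s1S.
  rewrite inE in vS; exists v; last by exists u.
  apply/mem_seg; exists (d v); last exact/eqP.
  by rewrite -sW' -(eqP vS).
have outa : {in s a :: s b :: arc ++ arc' ++ rest, forall z, z \notin W'}.
  move=> z; have [za _|za zl] := boolP (z \in arc').
    by move/mem_seg: za => [l ll ->]; rewrite inE !inE ds' ?eqxx.
  apply: (contra (@sub z)); apply: outc; rewrite (perm_mem permc).
  move: zl; rewrite -(perm_mem (perm_arcs _ _ _ _ _)) mem_cat (negPf za) orbF //.
have cW' : connected_in W' by apply: component_connected.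
have s'W l : s' l \in W -> s' (d (s' l)) = s' l /\ a <= d (s' l) <= b.
  by rewrite sW' => ll; rewrite ds' //; split=> //; case/andP: ll => /ltnW-> /ltnW->.
have s'l i' j' l : i' <= l <= j' -> s' l \in W -> d (s' l) = l.
  by move=> _; rewrite sW'; apply: ds'.
have al' : {in W, forall u l, i <= l <= j -> s' l \notin W -> adj u (s' l) ->
    d u = l.+1 \/ l = (d u).+1}.
  by move=> u uW l ll; rewrite sW' => /es' ->; apply: al.
(* If the new territory touches the old stretch [arc], it misses the rest of the cycle: [arc] lies
   below [b], so the half guard covers it and the guard of [T] is freed. Otherwise [s'] and [T]
   enclose it and the half guard is freed. *)
have [tp|ntp] := boolp.pselect (touches W' arc).
  have ntq := theta_arcs drawing uqa pathp parc' pathq cW' outa tp tS.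
  have eqL : seg s' a b.+1 ++ rev arc = s a :: arc' ++ s b :: rev arc.
    by rewrite segab !(cat_cons, =^~ catA).
  case: (@fence_component _ W s' a b (rev arc) d h r a.+1) => //.
  - by move=> l ll; apply: sadj'; move: ll ia bj; clear; lia.
  - exact: s'l.
  - by move=> v; rewrite mem_rev => va; apply: outc; rewrite segT mem_cat inE mem_cat va !orbT.
  - rewrite eqL; move: uqa; rewrite -(perm_uniq (perm_arcs_rev _ _ _ _ _)) cat_uniq.
    by case/andP.
  - by rewrite eqL -[_ :: _]cat0s cycle_arcs cats0 parc' rev_arc.
  - by move=> u uW l ll; apply: al' => //; move: ll ia bj; clear; lia.
  - apply: (half_guard_covers ss dl al bj1 bmin) => v.
    rewrite -[in_mem _ _]/(v \in rev arc) mem_rev => /mem_seg[l /andP[al1 lb] ->].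
    by exists l => //; split=> //; move: al1 lb ia bj; clear; lia.
  - move=> u uW' v vW auv; have := bd u (sub _ uW') v vW auv.
    rewrite -[in_mem _ _]/(v \in _ ++ _) (perm_mem permc) eqL.
    have := not_touches ntq uW' auv; rewrite !(inE, mem_cat) mem_rev => /negPf nr.
    by case/or4P=> [->|->|->|]; rewrite ?orbT ?nr.
  move=> fW' rW' lt.
  exact/win_swap12/win_rev/(IHf _ _ _ _ _ _ _ (leq_trans lt Wn) fW' r rW').
case: (@fence_component _ W s' i j T d g r a.+1) => //.
- by move=> l /s'W[-> ll]; split=> //; move: ll ia bj; clear; lia.
- exact: s'l.
- rewrite segT' (perm_uniq (perm_rot_arcs _ _ _ _ _)).
  by move: uqa; rewrite -(perm_uniq (perm_arcs_r _ _ _ _ _)) cat_uniq => /andP[].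
- by rewrite segT' cycle_arcs parc'.
- move=> u uW' v vW auv; have := bd u (sub _ uW') v vW auv.
  rewrite -[in_mem _ _]/(v \in _ ++ _) segT segT'.
  have := not_touches ntp uW' auv; rewrite !(inE, mem_cat) => /negPf ->.
  by case/or4P=> [->|->|//|->]; rewrite ?orbT.
move=> fW' rW' lt.
exact/win_rev/(IHf _ _ _ _ _ _ _ (leq_trans lt Wn) fW' r rW').
Qed.

End FenceStep.

(** * The induction on the size of the territory *)

Section FourCops.
Variable G : sgraph.
Hypotheses (connG : connected_graph G) (bipG : bipartite G).
Variables (rho : G -> G -> G -> bool) (sigma : rel G).
Hypothesis drawing : parity_drawing rho sigma.

(** The order matters: at size [n.+1] the cycle case relies on the point case, and the fence case on
    the cycle case. *)
Lemma territories_win n : [/\ fence_win G n, cycle_win G n & point_win G n].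
Proof.
elim: n => [|n [IHf IHc IHp]]; first by split=> W.
have Hp := point_step connG bipG IHf IHp.
have Hc := cycle_step connG bipG drawing IHf Hp.
by split=> //; apply: (fence_win_step connG drawing IHf).
Qed.

Lemma four_cops : surrounding_cop_number G <= 4.
Proof.
rewrite /surrounding_cop_number; case: ex_minnP => m _ mmin.
(* On the empty graph a team of [#|G|], that is zero, cops wins. *)
have [x0 _|G0] := pickP (mem (@predT G)); last first.
  have := mmin #|G|; rewrite (eq_card0 G0) => /(_ _)/leq_trans; apply=> //.
  by rewrite -(eq_card0 G0); apply/boolp.asboolP; apply: cops_win_card.
apply: mmin; apply/boolp.asboolP.
apply: (@win_strategy _ [:: x0; x0; x0; x0]) => // r.
(* All cops wait on [x0] until the robber has moved, which forces him off [x0]; his component of the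
   complement is a point territory. *)
exists [:: x0; x0; x0; x0]; first by rewrite /= stepxx.
split=> r' _ ; rewrite !inE !negb_or => /and4P[r'x _ _ _].
exists [:: x0; x0; x0; x0]; first by rewrite /= stepxx.
have [_ _ Hp] := territories_win #|G|.+1.
set W := component (~: [set x0]) r'.
have r'W : r' \in ~: [set x0] by rewrite !inE.
apply: (Hp W x0) => //.
- by rewrite ltnS max_card.
- exact: component_connected.
- by rewrite !inE eqxx.
- move=> u uW v vW auv; rewrite inE; apply: contraNT vW => vx.
  by apply: component_closed uW _ auv; rewrite !inE.
- exact: mem_component.
Qed.

End FourCops.

(** * Polygonal approximation of a plane drawing *)

Section Segments.
Variable R : realFieldType.
Local Open Scope ring_scope.
Implicit Types (a b c d p u v w z : R * R).

Definition lex p q := (p.1 < q.1) || ((p.1 == q.1) && (p.2 < q.2)).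

Lemma lex_total p q : p != q -> lex p q = ~~ lex q p.
Proof.
case: p q => p1 p2 [q1 q2]; rewrite xpair_eqE /lex /= => ne.
case: (ltgtP p1 q1) ne => //= _; case: (ltgtP p2 q2) => //.
Qed.

Lemma lexxx p : lex p p = false.
Proof. by rewrite /lex !ltxx andbF. Qed.

Lemma lex_trans p q r : lex p q -> lex q r -> lex p r.
Proof.
case: p q r => p1 p2 [q1 q2] [r1 r2]; rewrite /lex /=.
case/orP=> [h1|/andP[/eqP<- h1]]; case/orP=> [h2|/andP[/eqP<- h2]].
- by rewrite (lt_trans h1).
- by rewrite h1.
- by rewrite h2.
by rewrite eqxx (lt_trans h1) ?orbT.
Qed.

Definition cross u v := u.1 * v.2 - u.2 * v.1.

Definition orient a b z := cross (b.1 - a.1, b.2 - a.2) (z.1 - a.1, z.2 - a.2).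

Definition on_segment a b z :=
  exists2 s : R, 0 <= s <= 1 & z = (a.1 + s * (b.1 - a.1), a.2 + s * (b.2 - a.2)).

Definition right u := (0 < u.1) || ((u.1 == 0) && (0 < u.2)).

Lemma lex_right a b : lex a b = right (b.1 - a.1, b.2 - a.2).
Proof. by rewrite /lex /right /= !subr_gt0 subr_eq0 [b.1 == _]eq_sym. Qed.

Lemma sign_contra (k x y : R) : 0 < x -> 0 < y -> 0 < k * x -> 0 < k * - y -> False.
Proof.
move=> x0 y0; rewrite pmulr_lgt0 // mulrN oppr_gt0 pmulr_llt0 // => h1 h2.
by move: (lt_trans h1 h2); rewrite ltxx.
Qed.

(** For directions in the right half-plane a positive cross product compares slopes, which is
    transitive. The factor [k] treats both orientations at once, and [id] is a Plücker relation. *)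
Lemma cross_trans (k : R) u v w : right u -> right v -> right w ->
  0 < k * cross u v -> 0 < k * cross v w -> 0 < k * cross u w.
Proof.
case: u v w => u1 u2 [v1 v2] [w1 w2]; rewrite /right /cross /=.
have id : v1 * (k * (u1 * w2 - u2 * w1)) =
    u1 * (k * (v1 * w2 - v2 * w1)) + w1 * (k * (u1 * v2 - u2 * v1)) by ring.
case/orP=> [hu|/andP[/eqP hu hu']]; case/orP=> [hv|/andP[/eqP hv hv']];
  case/orP=> [hw|/andP[/eqP hw hw']] h1 h2.
- by rewrite -(pmulr_rgt0 _ hv) id; apply: addr_gt0; apply: mulr_gt0.
- rewrite -(pmulr_rgt0 _ hv) id; apply: ltr_wpDr; last exact: mulr_gt0.
  by apply: mulr_ge0; [rewrite hw|apply: ltW].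
- case: (sign_contra (k := k) (mulr_gt0 hu hv') (mulr_gt0 hv' hw)).
    by move: h1; rewrite hv mulr0 subr0.
  by move: h2; rewrite hv mul0r sub0r.
- by move: h2; rewrite hv hw mul0r mulr0 subr0 mulr0 ltxx.
- rewrite -(pmulr_rgt0 _ hv) id; apply: ltr_wpDl; last exact: mulr_gt0.
  by apply: mulr_ge0; [rewrite hu|apply: ltW].
- case: (sign_contra (k := k) (mulr_gt0 hv hw') (mulr_gt0 hu' hv)).
    by move: h2; rewrite hw mulr0 subr0.
  by move: h1; rewrite hu mul0r sub0r.
- by move: h1; rewrite hu hv mul0r mulr0 subr0 mulr0 ltxx.
by move: h1; rewrite hu hv mul0r mulr0 subr0 mulr0 ltxx.
Qed.

Lemma orient0_segment a b z : lex a z -> lex z b -> orient a b z = 0 -> on_segment a b z.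
Proof.
case: a b z => a1 a2 [b1 b2] [z1 z2]; rewrite /lex /orient /cross /= => h1 h2 e.
have az : a1 <= z1 by case/orP: h1 => [/ltW//|/andP[/eqP->]].
have zb : z1 <= b1 by case/orP: h2 => [/ltW//|/andP[/eqP->]].
have [ab|ab] := ltP a1 b1.
  exists ((z1 - a1) / (b1 - a1)).
    by rewrite divr_ge0 ?subr_ge0 //= ?(ltW ab) // ler_pdivrMr ?subr_gt0 // mul1r lerD2r.
  have ne : b1 - a1 != 0 by rewrite subr_eq0 gt_eqF.
  rewrite /= divfK // (_ : (z1 - a1) / (b1 - a1) * (b2 - a2) = z2 - a2).
    by rewrite ![_ + (_ - _)]addrC !subrK.
  apply: (mulfI ne); rewrite mulrA mulrCA divff // mulr1; lra.
(* The segment is vertical, and the second coordinate gives the parameter. *)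
have {ab az zb} [e1 e2] : z1 = a1 /\ b1 = a1 by lra.
rewrite e1 e2 ltxx eqxx /= in h1 h2 *.
exists ((z2 - a2) / (b2 - a2)).
  have ab : a2 < b2 by exact: lt_trans h1 h2.
  by rewrite divr_ge0 ?subr_ge0 //= ?(ltW ab) // ?ler_pdivrMr ?subr_gt0 // ?mul1r ?lerD2r // ltW.
have ne : b2 - a2 != 0 by rewrite subr_eq0 gt_eqF // (lt_trans h1 h2).
by rewrite subrr mulr0 addr0 divfK // [a2 + _]addrC subrK.
Qed.

(** The hypotheses order the directions involved by slope, and transitivity of this order puts the
    parameters of the intersection point in the unit interval. *)
Lemma interleaved_meet (k : R) a b c d : lex a c -> lex c b -> lex b d ->
  0 < k * orient a b c -> 0 < k * orient c d b ->
  exists2 z, on_segment a b z & on_segment c d z.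
Proof.
move=> ac cb bd; have ab := lex_trans ac cb; have cd := lex_trans cb bd.
move: ac cb bd ab cd; rewrite !lex_right /orient.
set u := (b.1 - a.1, _); set w := (c.1 - a.1, _); set v := (d.1 - c.1, _).
set x := (b.1 - c.1, _); set e := (d.1 - b.1, _) => rw rx re ru rv h1 h2.
have xw : 0 < k * cross x w by move: h1; rewrite /cross /=; lra.
have ex : 0 < k * cross e x by move: h2; rewrite /cross /=; lra.
have xu : 0 < k * cross x u by move: h1; rewrite /cross /=; lra.
have eu := cross_trans re rx ru ex xu; have ew := cross_trans re rx rw ex xw.
have D0 : 0 < k * cross v u by move: eu xu; rewrite /cross /=; lra.
have k0 : k != 0 by apply: contraTneq D0 => ->; rewrite mul0r ltxx.
have nD : cross v u != 0 by apply: contraTneq D0 => ->; rewrite mulr0 ltxx.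
have frac y : y / cross v u = (k * y) / (k * cross v u) by rewrite -mulf_div divff // mul1r.
have key1 : cross v w * u.1 - cross u w * v.1 = cross v u * w.1 by rewrite /cross /=; ring.
have key2 : cross v w * u.2 - cross u w * v.2 = cross v u * w.2 by rewrite /cross /=; ring.
(* Cramer's rule for [a + s u = c + t v] with [w = c - a]. *)
exists (a.1 + cross v w / cross v u * u.1, a.2 + cross v w / cross v u * u.2).
  exists (cross v w / cross v u) => //; rewrite frac.
  rewrite divr_ge0 ?(ltW D0) //= ?ler_pdivrMr // ?mul1r.
    by move: ex; rewrite /cross /=; lra.
  by move: ew xw; rewrite /cross /=; lra.
exists (cross u w / cross v u).
  rewrite frac divr_ge0 ?(ltW D0) //= ?ler_pdivrMr // ?mul1r ?(ltW h1) //.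
  by move: eu; rewrite /cross /=; lra.
have sol y1 y2 y3 : cross v w * y1 - cross u w * y2 = cross v u * y3 ->
    cross v w / cross v u * y1 = y3 + cross u w / cross v u * y2.
  move=> E; apply: (mulfI nD); rewrite mulrDr -E ![_ / _ * _]mulrAC ![cross v u * (_ / _)]mulrC.
  by rewrite !divfK // subrK.
congr (_, _); rewrite (sol _ _ _ key1) || rewrite (sol _ _ _ key2).
  by rewrite /w /= addrA [a.1 + _]addrC subrK.
by rewrite /w /= addrA [a.2 + _]addrC subrK.
Qed.

Lemma right_convex u v (t : R) : right u -> right v -> 0 <= t <= 1 ->
  right (u.1 + t * (v.1 - u.1), u.2 + t * (v.2 - u.2)).
Proof.
move=> ru rv /andP[]; rewrite le_eqVlt => /predU1P[<-|t0]; first by rewrite !mul0r !addr0 /right.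
rewrite le_eqVlt => /predU1P[->|t1]; first by rewrite !mul1r [u.1 + _]addrC [u.2 + _]addrC !subrK.
have -> : u.1 + t * (v.1 - u.1) = (1 - t) * u.1 + t * v.1 by ring.
have -> : u.2 + t * (v.2 - u.2) = (1 - t) * u.2 + t * v.2 by ring.
have t1' : 0 < 1 - t by rewrite subr_gt0.
move: ru rv; rewrite /right /=; case/orP=> [h1|/andP[/eqP-> h1]]; case/orP=> [h2|/andP[/eqP-> h2]].
- by rewrite addr_gt0 ?mulr_gt0.
- by rewrite mulr0 addr0 mulr_gt0.
- by rewrite mulr0 add0r mulr_gt0.
by rewrite !mulr0 addr0 eqxx addr_gt0 ?mulr_gt0 ?orbT.
Qed.

(** Along [c d] the function [orient a b] is affine and changes sign; its zero stays
    lexicographically between [a] and [b] by convexity. *)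
Lemma nested_meet a b c d : lex a c -> lex c b -> lex a d -> lex d b ->
  orient a b c < 0 -> 0 < orient a b d ->
  exists2 z, on_segment a b z & on_segment c d z.
Proof.
move=> ac cb ad db oc od.
have D0 : 0 < orient a b d - orient a b c by lra.
set t := - orient a b c / (orient a b d - orient a b c).
have t01 : 0 <= t <= 1.
  rewrite divr_ge0 ?(ltW D0) ?oppr_ge0 ?(ltW oc) //= ler_pdivrMr // mul1r; lra.
exists (c.1 + t * (d.1 - c.1), c.2 + t * (d.2 - c.2)); last by exists t.
apply: orient0_segment.
- have := right_convex _ _ t01; move: ac ad; rewrite !lex_right => ac ad /(_ _ _ ac ad) /=.
  by congr (is_true (right (_, _))); ring.
- have := right_convex _ _ t01; move: cb db; rewrite !lex_right => cb db /(_ _ _ cb db) /=.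
  by congr (is_true (right (_, _))); ring.
transitivity (orient a b c + t * (orient a b d - orient a b c)).
  by rewrite /orient /cross /=; ring.
by rewrite divfK ?gt_eqF // subrr.
Qed.

Lemma on_segment_sym a b z : on_segment a b z -> on_segment b a z.
Proof.
case=> s /andP[s0 s1] ->; exists (1 - s); last by congr (_, _); ring.
by apply/andP; split; lra.
Qed.

Lemma on_segment_start a b : on_segment a b a.
Proof. by exists 0; rewrite ?lexx ?ler01 // !mul0r !addr0 -surjective_pairing. Qed.

Lemma on_segment_end a b : on_segment a b b.
Proof. exact/on_segment_sym/on_segment_start. Qed.

(* Whether the upward ray from [z] meets the segment [a b]; the ray is tilted
   infinitesimally, which [lex] makes precise, so that no genericity is needed. *)
Definition ray a b z := [&& lex a z, lex z b & orient a b z < 0] ||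
  [&& lex b z, lex z a & orient b a z < 0].

Lemma ray_sym a b z : ray a b z = ray b a z.
Proof. exact: orbC. Qed.

Lemma ray_lex a b z : lex a b -> ray a b z = [&& lex a z, lex z b & orient a b z < 0].
Proof.
move=> ab; rewrite /ray orb_idr // => /and3P[bz za _].
by have := lex_trans ab (lex_trans bz za); rewrite lexxx.
Qed.

Lemma lex_asym a b : lex a b -> lex b a = false.
Proof. by move=> ab; apply/negP => /(lex_trans ab); rewrite lexxx. Qed.

Lemma lex_cases a b : a != b -> lex a b \/ lex b a.
Proof. by move/lex_total => ->; case: (lex b a); [right|left]. Qed.

Definition disjoint_segments a b c d :=
  forall z, on_segment a b z -> on_segment c d z -> False.

Definition parity_law a b c d :=
  ray a b d (+) ray a b c (+) (ray c d b (+) ray c d a) =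
  lex b d (+) lex b c (+) (lex a d (+) lex a c).

(** The order [a b c d] is immediate. For [a c b d] a violation gives two orientations of equal
    sign, and for [a c d b] it puts [c] and [d] on opposite sides of [a b]; either way the segments
    meet. *)
Lemma parity_lex a b c d : disjoint_segments a b c d ->
  lex a b -> lex c d -> lex a c -> b != c -> b != d -> parity_law a b c d.
Proof.
move=> dis ab cd ac nbc nbd; rewrite /parity_law (ray_lex _ ab) (ray_lex _ ab) !(ray_lex _ cd).
have ad := lex_trans ac cd; rewrite ac ad (lex_asym ac) /=.
have on0 z : on_segment c d z -> lex a z -> lex z b -> orient a b z != 0.
  by move=> zcd az zb; apply/eqP => /(orient0_segment az zb)/dis; apply.
case: (lex_cases nbc) => [bc|cb].
  have bd := lex_trans bc cd.
  by rewrite bc bd (lex_asym bc) (lex_asym bd).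
rewrite cb (lex_asym cb); case: (lex_cases nbd) => [bd|db].
  rewrite bd (lex_asym bd) /=.
  have oc := on0 c (on_segment_start _ _) ac cb.
  have ob : orient c d b != 0.
    by apply/eqP => /(orient0_segment cb bd); apply: dis; apply: on_segment_end.
  case: (ltgtP (orient a b c) 0) oc => [oc _|oc _|? /eqP[]//] //=;
    case: (ltgtP (orient c d b) 0) ob => [ob _|ob _|? /eqP[]//] //=; exfalso.
    have [||z] := @interleaved_meet (-1) a b c d ac cb bd; rewrite ?mulN1r ?oppr_gt0 //.
    exact: dis.
  have [||z] := @interleaved_meet 1 a b c d ac cb bd; rewrite ?mul1r //.
  exact: dis.
rewrite db (lex_asym db) /=.
have oc := on0 c (on_segment_start _ _) ac cb.
have od := on0 d (on_segment_end _ _) ad db.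
case: (ltgtP (orient a b c) 0) oc => [oc _|oc _|? /eqP[]//] //=;
  case: (ltgtP (orient a b d) 0) od => [od _|od _|? /eqP[]//] //=; exfalso.
  have [z] := nested_meet ac cb ad db oc od; exact: dis.
have [z zab /on_segment_sym] := nested_meet ad db ac cb od oc; exact: dis.
Qed.

(** Reversing a segment or exchanging the two preserves the law, which reduces it to the sorted
    case; degenerate segments make both sides vanish. *)
Lemma segments_parity a b c d : disjoint_segments a b c d -> parity_law a b c d.
Proof.
move=> dis.
have [<-|nab] := eqVneq a b.
  have r0 z : ray a a z = false.
    by apply/negP; rewrite /ray orbb => /and3P[h1 h2 _]; have := lex_trans h1 h2; rewrite lexxx.
  by rewrite /parity_law !r0 !addbb.
have [<-|ncd] := eqVneq c d.
  have r0 z : ray c c z = false.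
    by apply/negP; rewrite /ray orbb => /and3P[h1 h2 _]; have := lex_trans h1 h2; rewrite lexxx.
  by rewrite /parity_law !r0 !addbb.
have nac : a != c by apply/eqP => e; apply: (dis a); rewrite ?e; apply: on_segment_start.
have nad : a != d.
  by apply/eqP => e; apply: (dis a); rewrite ?e; [apply: on_segment_start|apply: on_segment_end].
have nbc : b != c.
  by apply/eqP => e; apply: (dis b); rewrite ?e; [apply: on_segment_end|apply: on_segment_start].
have nbd : b != d by apply/eqP => e; apply: (dis b); rewrite ?e; apply: on_segment_end.
have swap1 : parity_law b a c d -> parity_law a b c d.
  by rewrite /parity_law ![ray b a _]ray_sym [ray c d a (+) _]addbC => ->; exact: addbC.
have swap2 a' b' : parity_law a' b' d c -> parity_law a' b' c d.
  by rewrite /parity_law ![ray d c _]ray_sym [ray a' b' c (+) _]addbC => ->;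
     rewrite ![lex _ c (+) _]addbC.
have sorted a' b' c' d' : disjoint_segments a' b' c' d' -> a' != c' -> a' != d' ->
    b' != c' -> b' != d' -> lex a' b' -> lex c' d' -> parity_law a' b' c' d'.
  move=> dis' n1 n2 n3 n4 ab cd; case: (lex_cases n1) => [ac|ca]; first exact: parity_lex.
  have dis2 : disjoint_segments c' d' a' b' by move=> z h1 h2; apply: dis' h2 h1.
  have := parity_lex dis2 cd ab ca; rewrite /parity_law eq_sym n2 eq_sym n4 => /(_ isT isT).
  rewrite addbC => ->; rewrite (lex_total n1) (lex_total n2) (lex_total n3) (lex_total n4).
  by case: (lex _ _) (lex _ _) (lex _ _) (lex _ _) => [] [] [] [].
case: (lex_cases nab) => [ab|ba]; [|apply: swap1]; case: (lex_cases ncd) => [cd|dc].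
- exact: sorted.
- by apply: swap2; apply: sorted => // z h1 /on_segment_sym; apply: dis.
- by apply: sorted => // z /on_segment_sym h1; apply: dis.
by apply: swap2; apply: sorted => // z /on_segment_sym h1 /on_segment_sym; apply: dis.
Qed.

End Segments.

From mathcomp Require Import all_classical all_reals all_analysis.
Import numFieldNormedType.Exports.

(** * From disjoint curves to disjoint polylines *)

Section Curves.
Variable R : realType.
Local Open Scope classical_set_scope.
Local Open Scope ring_scope.
Implicit Types (f g : R -> R * R) (s t : R).

Definition near_pt (e : R) (p q : R * R) := `|p.1 - q.1| < e /\ `|p.2 - q.2| < e.

Lemma segment_near (e : R) p a b z : near_pt e p a -> near_pt e p b ->
  on_segment a b z -> near_pt e p z.
Proof.
have mid (x y1 y2 s : R) : `|x - y1| < e -> `|x - y2| < e -> 0 <= s <= 1 ->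
    `|x - (y1 + s * (y2 - y1))| < e.
  move=> h1 h2 /andP[s0 s1]; rewrite (_ : x - _ = (1 - s) * (x - y1) + s * (x - y2)); last by ring.
  apply: le_lt_trans (ler_normD _ _) _; rewrite !normrM (ger0_norm s0) ger0_norm ?subr_ge0 //.
  have hA : (1 - s) * `|x - y1| <= (1 - s) * e by rewrite ler_wpM2l ?subr_ge0 // ltW.
  have [->|sn0] := eqVneq s 0; first by rewrite subr0 mul1r mul0r addr0.
  have hB : s * `|x - y2| < s * e by rewrite ltr_pM2l // lt_neqAle eq_sym sn0.
  lra.
by move=> [a1 a2] [b1 b2] [s s01 ->]; split=> /=; apply: mid.
Qed.

Lemma within_ball f s : {within `[0, 1], continuous f} -> 0 <= s <= 1 ->
  forall e : R, 0 < e -> exists2 del : R, 0 < del &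
  forall t, 0 <= t <= 1 -> `|s - t| < del -> near_pt e (f s) (f t).
Proof.
move=> /subspace_continuousP cf s01 e e0.
have s01' : `[0, 1]%classic s by rewrite /= in_itv.
have /cf /(_ (ball (f s) e) (nbhsx_ballx _ _ e0)) := s01'.
rewrite nbhs_simpl /= => /nbhs_ballP[del /= del0 sub]; exists del => // t t01 st.
have := sub t; rewrite -ball_normE /= => /(_ st).
rewrite in_itv /= => /(_ t01) [/=]; rewrite -!ball_normE /=; by split.
Qed.

(** Near a pair of parameters both curves, and by convexity their short chords, stay within half the
    distance of the two points. Compactness of the unit square makes the mesh uniform. *)
Lemma curves_apart f g : {within `[0, 1], continuous f} -> {within `[0, 1], continuous g} ->
  (forall s t, 0 <= s <= 1 -> 0 <= t <= 1 -> f s <> g t) ->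
  \forall n \near \oo, forall s t s' t', 0 <= s <= 1 -> 0 <= t <= 1 ->
    0 <= s' <= 1 -> 0 <= t' <= 1 -> `|s - s'| <= n.+1%:R^-1 -> `|t - t'| <= n.+1%:R^-1 ->
    disjoint_segments (f s) (f s') (g t) (g t').
Proof.
move=> cf cg fg.
pose K : set (R * R) := `[0, 1]%classic `*` `[0, 1]%classic.
have cK : compact K by apply: compact_setX; apply: segment_compact.
pose P (n : nat) (p : R * R) := forall s' t', 0 <= s' <= 1 -> 0 <= t' <= 1 ->
  `|p.1 - s'| <= n.+1%:R^-1 -> `|p.2 - t'| <= n.+1%:R^-1 ->
  disjoint_segments (f p.1) (f s') (g p.2) (g t').
have : \forall n \near \oo, K `<=` P n; last first.
  apply: filterS => n sub s t s' t' s01 t01 s01' t01' h1 h2.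
  by apply: (sub (s, t)) => //; split; rewrite /= in_itv.
move/compact_near_coveringP/near_covering_withinP : cK; apply => -[s t] [/= s01 t01].
rewrite in_itv /= in s01; rewrite in_itv /= in t01.
pose e := Num.max `|(f s).1 - (g t).1| `|(f s).2 - (g t).2| / 2.
have e0 : 0 < e.
  rewrite divr_gt0 // lt_max !normr_gt0 !subr_eq0 -negb_and; apply/negP => /andP[/eqP e1 /eqP e2].
  by apply: (fg s t s01 t01); rewrite [f s]surjective_pairing [g t]surjective_pairing e1 e2.
have [d1 d10 near_f] := within_ball cf s01 e0.
have [d2 d20 near_g] := within_ball cg t01 e0.
(* Half of [d] is spent on moving the base parameters, the other half on the mesh. *)
have [d [d0 dd1 dd2]] : exists d, [/\ 0 < d / 2, d <= d1 & d <= d2].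
  exists (Num.min d1 d2); rewrite divr_gt0 ?lt_min ?d10 //.
  by rewrite !ge_min !lexx orbT.
exists (ball (s, t) (d / 2), [set n | n.+1%:R^-1 < d / 2]).
  split; first exact: nbhsx_ballx.
  exact: (near_infty_natSinv_lt (PosNum d0)).
move=> [[s1 t1] n] /= [[/= bs bt] nd] [/=]; rewrite !in_itv /= => s101 t101 s' t' s'01 t'01 h1 h2.
move: bs bt; rewrite -!ball_normE /= => bs bt.
have far (x y z c : R) : `|x - y| < d / 2 -> `|y - z| <= n.+1%:R^-1 -> d <= c -> `|x - z| < c.
  move=> xy yz dc; apply: le_lt_trans (ler_distD y x z) _; apply: lt_le_trans dc.
  by rewrite [d]splitr ltrD // (le_lt_trans yz).
have far0 (x y c : R) : `|x - y| < d / 2 -> d <= c -> `|x - y| < c.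
  by move=> xy dc; lra.
move=> z zf zg.
have [zf1 zf2] := segment_near (near_f _ s101 (far0 _ _ _ bs dd1))
  (near_f _ s'01 (far _ _ _ _ bs h1 dd1)) zf.
have [zg1 zg2] := segment_near (near_g _ t101 (far0 _ _ _ bt dd2))
  (near_g _ t'01 (far _ _ _ _ bt h2 dd2)) zg.
suff : Num.max `|(f s).1 - (g t).1| `|(f s).2 - (g t).2| < e + e by rewrite -splitr ltxx.
rewrite gt_max; apply/andP; split.
  by apply: le_lt_trans (ler_distD z.1 _ _) _; rewrite ltrD // distrC.
by apply: le_lt_trans (ler_distD z.2 _ _) _; rewrite ltrD // distrC.
Qed.

End Curves.

Section Polylines.
Variable R : realFieldType.
Local Open Scope ring_scope.
Implicit Types (f g : nat -> R * R) (z : R * R).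

Fixpoint polyline_ray f n z : bool :=
  if n is n'.+1 then polyline_ray f n' z + ray (f n') (f n'.+1) z else 0.

Lemma segments_parity_ring (a b c d : R * R) : disjoint_segments a b c d ->
  ray a b d - ray a b c + ray c d b - ray c d a =
  lex b d - lex b c - lex a d + lex a c :> bool.
Proof.
move/segments_parity; rewrite /parity_law.
by do 4 case: (ray _ _ _); do 4 case: (lex _ _).
Qed.

(** Telescoping over pieces, as in [walk_cross]. *)
Lemma polylines_parity f g m n :
  (forall k l, (k < m)%N -> (l < n)%N -> disjoint_segments (f k) (f k.+1) (g l) (g l.+1)) ->
  polyline_ray f m (g n) - polyline_ray f m (g 0%N) +
    polyline_ray g n (f m) - polyline_ray g n (f 0%N) =
  lex (f m) (g n) - lex (f m) (g 0%N) - lex (f 0%N) (g n) + lex (f 0%N) (g 0%N) :> bool.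
Proof.
have edge a b l : (forall k, (k < l)%N -> disjoint_segments a b (g k) (g k.+1)) ->
    ray a b (g l) - ray a b (g 0%N) + polyline_ray g l b - polyline_ray g l a =
    lex b (g l) - lex b (g 0%N) - lex a (g l) + lex a (g 0%N) :> bool.
  elim: l => [|l IH] dis /=; first by ring.
  have E1 := IH (fun k kl => dis k (leqW kl)).
  have E := congr2 +%R E1 (segments_parity_ring (dis l (ltnSn l))).
  rewrite [RHS](_ : _ = lex b (g l) - lex b (g 0%N) - lex a (g l) + lex a (g 0%N) +
    (lex b (g l.+1) - lex b (g l) - lex a (g l.+1) + lex a (g l))); last by ring.
  rewrite -E; ring.
elim: m => [|m IH] dis /=; first by ring.
have E1 := IH (fun k l km => dis k l (leqW km)).
have E := congr2 +%R E1 (edge (f m) (f m.+1) n (fun l => dis m l (ltnSn m))).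
rewrite [RHS](_ : _ = lex (f m) (g n) - lex (f m) (g 0%N) - lex (f 0%N) (g n) +
   lex (f 0%N) (g 0%N) + (lex (f m.+1) (g n) - lex (f m.+1) (g 0%N) -
   lex (f m) (g n) + lex (f m) (g 0%N))); last by ring.
rewrite -E; ring.
Qed.

End Polylines.

Section Drawing.
Variables (R : realType) (G : sgraph) (pos : G -> R * R) (arc : G -> G -> R -> R * R).
Hypothesis draw : plane_drawing pos arc.
Local Open Scope classical_set_scope.
Local Open Scope ring_scope.

Lemma arcs_disjoint x y u v s t : adj x y -> adj u v -> ~~ has (mem [:: x; y]) [:: u; v] ->
  0 <= s <= 1 -> 0 <= t <= 1 -> arc x y s <> arc u v t.
Proof.
move=> axy auv; rewrite /= !inE !negb_or => /and3P[/andP[ux uy] /andP[vx vy] _].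
have sym a b c : a <> b -> b <> a by move=> ? ?; auto.
have inner a b z r : adj a b -> 0 < r < 1 -> arc a b r <> pos z.
  by move=> aab r01; apply: (arc_avoids_vertices draw) => //; rewrite in_itv.
have ends a b r : adj a b -> 0 <= r <= 1 -> 
    [\/ 0 < r < 1, arc a b r = pos a | arc a b r = pos b].
  move=> aab /andP[]; rewrite le_eqVlt => /predU1P[<-|r0].
    by rewrite (arc_start draw) //; constructor 2.
  rewrite le_eqVlt => /predU1P[->|r1]; last by constructor 1; rewrite r0.
  by rewrite (arc_end draw) //; constructor 3.
have pos_ne a b : a != b -> pos a <> pos b by move=> /eqP ab /(pos_inj draw).
move=> s01 t01; case: (ends _ _ _ axy s01) => [s01'|->|->];
  case: (ends _ _ _ auv t01) => [t01'|->|->];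
  try (by apply: inner); try (by apply/nesym/inner); try (by apply: pos_ne; rewrite eq_sym).
apply: (arc_disjoint draw) => //; rewrite ?in_itv //.
by apply: contraNneq ux => /setP/(_ u); rewrite !inE eqxx (negPf uy) orbF.
Qed.

Lemma drawing_parity : exists rho sigma, @parity_drawing G rho sigma.
Proof.
have : \forall n \near \oo, forall e : G * G * (G * G), adj e.1.1 e.1.2 -> adj e.2.1 e.2.2 ->
    ~~ has (mem [:: e.1.1; e.1.2]) [:: e.2.1; e.2.2] ->
    forall s t s' t', 0 <= s <= 1 -> 0 <= t <= 1 ->
    0 <= s' <= 1 -> 0 <= t' <= 1 -> `|s - s'| <= n.+1%:R^-1 -> `|t - t'| <= n.+1%:R^-1 ->
    disjoint_segments (arc e.1.1 e.1.2 s) (arc e.1.1 e.1.2 s')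
                      (arc e.2.1 e.2.2 t) (arc e.2.1 e.2.2 t').
  (* Finitely many pairs of edges, so one mesh serves them all. *)
  apply: filter_forall => -[[x y] [u v]] /=.
  have [axy|] := boolP (adj x y); last by move=> _; apply: nearW.
  have [auv|] := boolP (adj u v); last by move=> _; apply: nearW.
  have [dis|] := boolP (~~ has (mem [:: x; y]) [:: u; v]); last by move=> _; apply: nearW.
  apply: filterS (curves_apart (arc_continuous draw axy) (arc_continuous draw auv) _).
    by move=> n h _ _ _; apply: h.
  by move=> s t; apply: arcs_disjoint.
case=> N _ /(_ N (leqnn N)) fine.
(* Each arc is cut into [N.+1] pieces, which matches the mesh [N.+1%:R^-1] of [fine]. *)
pose pt x y k : R * R := arc x y (k%:R / N.+1%:R).
exists (fun x y z => polyline_ray (pt x y) N.+1 (pos z)), (fun x y => lex (pos x) (pos y)).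
have pt0 x y : adj x y -> pt x y 0%N = pos x.
  by move=> axy; rewrite /pt mul0r (arc_start draw).
have ptN x y : adj x y -> pt x y N.+1 = pos y.
  by move=> axy; rewrite /pt divff ?pnatr_eq0 // (arc_end draw).
have frac k : (k <= N.+1)%N -> 0 <= (k%:R / N.+1%:R : R) <= 1.
  by move=> kN; rewrite divr_ge0 ?ler0n //= ler_pdivrMr ?ltr0n // mul1r ler_nat.
have next k : `|k%:R / N.+1%:R - k.+1%:R / N.+1%:R : R| <= N.+1%:R^-1.
  by rewrite -mulrBl -natr1 opprD addrA subrr sub0r mulN1r normrN ger0_norm ?invr_ge0.
split=> [x y xy|a b c d aab acd dis].
  have : pos x != pos y by apply: contraNneq xy => /(pos_inj draw)->.
  by move/lex_total => ->; case: (lex _ _).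
rewrite -!(pt0 _ _ aab) -!(ptN _ _ aab) -!(pt0 _ _ acd) -!(ptN _ _ acd).
apply: polylines_parity => k l kN lN.
by apply: (fine ((a, b), (c, d))) => //=; apply: frac => //; apply: ltnW.
Qed.

End Drawing.

Theorem theorem3p5 (R : realType) (G : sgraph) :
  connected_graph G -> bipartite G -> planar R G ->
  (surrounding_cop_number G <= 4)%N.
Proof.
move=> connG bipG [pos [arc /drawing_parity[rho [sigma drawing]]]].
exact (four_cops connG bipG drawing).
Qed.
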